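(* Let $\alpha>0$ be fixed. Let $\Omega\colon\mathbb{R}\to\mathbb{R}_+$ be a continual diagram and let $a<a_0<b_0<b$ be real numbers such that: (i) the restriction of $\Omega$ to $[a,b]$ is $(1-\delta)$-Lipschitz for some constant $\delta>0$; (ii) the restriction of the transition measure $\mu_\Omega$ to $[a,b]$ is absolutely continuous with a density bounded from above by some constant. Let $(\omega_n)_{n\ge1}$ be a sequence of random continual diagrams such that \[ n^{\alpha}\log n\cdot d(\Omega,\omega_n)\xrightarrow[n\to\infty]{P}0 .\] Then \[ n^{\alpha}\sup_{z\in[a_0,b_0]}\big|K_{\omega_n}(z)-K_{\Omega}(z)\big|\xrightarrow[n\to\infty]{P}0.\]
   Context: A continual diagram is a function $\omega\colon\mathbb{R}\to\mathbb{R}_+$ such that $|\omega(z_1)-\omega(z_2)|\le|z_1-z_2|$ for all $z_1,z_2\in\mathbb{R}$, and $\omega(z)=|z|$ for all sufficiently large $|z|$. Transition measure: for a continual diagram $\omega$, its Cauchy transform $\mathbf{G}_\omega$ is defined for $z\in\mathbb{C}\setminus\mathbb{R}$ by \[\log\big[z\,\mathbf{G}_\omega(z)\big]=-\int_{-\infty}^{\infty}\frac{1}{z-w}\left(\frac{\omega(w)-|w|}{2}\right)'\,dw,\] and the transition measure $\mu_\omega$ is the unique (compactly supported) probability measure on $\mathbb{R}$ with $\mathbf{G}_\omega(z)=\int\frac{1}{z-x}\,d\mu_\omega(x)$. The cumulative function is $K_\omega(z)=\mu_\omega((-\infty,z])$. Metric $d$: for $x,y\ge0$ write $(x,y)\in\omega$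 if $\omega(x-y)=x+y$. For $x\ge0$ let $\Pi^\omega_Y(x)=\{y\ge 0:(x,y)\in\omega\}$ and for $y\ge0$ let $\Pi^\omega_X(y)=\{x\ge0:(x,y)\in\omega\}$. Define $d_Y(\omega_1,\omega_2)=\sup_{x\ge0}d_H(\Pi_Y^{\omega_1}(x),\Pi_Y^{\omega_2}(x))$, $d_X(\omega_1,\omega_2)=\sup_{y\ge0}d_H(\Pi_X^{\omega_1}(y),\Pi_X^{\omega_2}(y))$ with $d_H$ the Hausdorff distance, and $d=\max(d_X,d_Y)$. $\xrightarrow{P}$ denotes convergence in probability. *)

(* Defs.v *)
From HB Require Import structures.
From mathcomp Require Import all_boot all_order all_algebra.
From mathcomp Require Import all_classical all_reals all_analysis.
Set Implicit Arguments.
Unset Strict Implicit.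
Unset Printing Implicit Defensive.
Import Order.TTheory GRing.Theory Num.Theory.
Import numFieldNormedType.Exports.
Local Open Scope classical_set_scope.
Local Open Scope ring_scope.

Section Defs.
Variable R : realType.

Definition continual_diagram (w : R -> R) : Prop :=
  [/\ (forall z, 0 <= w z),
      (forall z1 z2, `|w z1 - w z2| <= `|z1 - z2|) &
      (exists C : R, forall z, C <= `|z| -> w z = `|z|)].

Definition half_diff (w : R -> R) : R -> R := fun v => (w v - `|v|) / 2.

(* For z = x + i y (y <> 0):
   1/(z - v) = (x - v)/((x-v)^2+y^2) - i * y/((x-v)^2+y^2). *)
Definition cauchy_re (x y v : R) : R := (x - v) / ((x - v) ^+ 2 + y ^+ 2).
Definition cauchy_im (x y v : R) : R := - y / ((x - v) ^+ 2 + y ^+ 2).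

Definition Lre (w : R -> R) (x y : R) : R :=
  Rintegral lebesgue_measure setT (fun v : R => cauchy_re x y v * derive1 (half_diff w) v).
Definition Lim_ (w : R -> R) (x y : R) : R :=
  Rintegral lebesgue_measure setT (fun v : R => cauchy_im x y v * derive1 (half_diff w) v).

Definition Gre (mu : probability R R) (x y : R) : R :=
  fine (\int[mu]_t (cauchy_re x y t)%:E).
Definition Gim (mu : probability R R) (x y : R) : R :=
  fine (\int[mu]_t (cauchy_im x y t)%:E).

(* mu is the transition measure of w: mu is a compactly supported probability
   measure whose Cauchy transform satisfies  log[z G(z)] = - L(z), i.e.
   z G(z) = exp(-L(z)) for every z = x + i y with y <> 0.
   With L = Lre + i Lim_, exp(-L) = e^{-Lre} (cos Lim_ - i sin Lim_), and
   z G = (x Gre - y Gim) + i (x Gim + y Gre). *)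
Definition transition_measure (w : R -> R) (mu : probability R R) : Prop :=
  (exists M : R, mu [set t | M < `|t|] = 0%E) /\
  forall x y : R, y != 0 ->
    x * Gre mu x y - y * Gim mu x y = expR (- Lre w x y) * cos (Lim_ w x y) /\
    x * Gim mu x y + y * Gre mu x y = - (expR (- Lre w x y) * sin (Lim_ w x y)).

Definition cumul (mu : probability R R) (z : R) : \bar R := mu `]-oo, z]%classic.

Definition hausdorff (A B : set R) : \bar R :=
  maxe (ereal_sup [set ereal_inf [set (`|a - b|)%:E | b in B] | a in A])
       (ereal_sup [set ereal_inf [set (`|a - b|)%:E | a in A] | b in B]).

(* (x,y) in w  iff  w(x - y) = x + y, with x, y >= 0 *)
Definition PiY (w : R -> R) (x : R) : set R := [set y | 0 <= y /\ w (x - y) = x + y].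
Definition PiX (w : R -> R) (y : R) : set R := [set x | 0 <= x /\ w (x - y) = x + y].

Definition dY (w1 w2 : R -> R) : \bar R :=
  ereal_sup [set hausdorff (PiY w1 x) (PiY w2 x) | x in [set x : R | 0 <= x]].
Definition dX (w1 w2 : R -> R) : \bar R :=
  ereal_sup [set hausdorff (PiX w1 y) (PiX w2 y) | y in [set y : R | 0 <= y]].
Definition dist_diag (w1 w2 : R -> R) : \bar R := maxe (dX w1 w2) (dY w1 w2).

End Defs.

Section Prob.
Context {R : realType} {d : measure_display} {T : measurableType d}.

(* outer probability: inf of P(B) over measurable B containing A
   (coincides with P(A) for measurable A) *)
Definition outerP (P : probability T R) (A : set T) : \bar R :=
  ereal_inf [set P B | B in [set B | measurable B /\ A `<=` B]].

Definition cvg_prob0 (P : probability T R) (X : nat -> T -> \bar R) : Prop :=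
  forall eps : R, 0 < eps ->
    (fun n => outerP P [set t | (eps%:E < `|X n t|)%E]) @ \oo --> 0%E.
End Prob.

(* Main.v *)
(* The cumulative function is read off the Cauchy transform along a vertical line,
     K(x) = 1/2 + (1/pi) int_0^oo Re G(x + i y) dy.
   Two diagrams at uniform distance e satisfy |log G_1 - log G_2| = O(e / y) by an
   integration by parts, hence |G_1 - G_2| = O(|G_1| e / y) for y >= e.  If
   |G_1(x + i y)| = O(1 / (1 + y)), then the parts y >= e of the two integrals
   differ by O(e ln(1 + 1/e)).  The parts y < e are removed by smoothing
   at scale e, which costs int e / (|x - t| + e) dmu(t); as a function of e this
   integral has derivative at most |Im G| / e, so the cost is O(e ln(1 + 1/e)) too.
   For the limit diagram, the bound on G near the real axis combines both
   hypotheses: by (ii) Im G is bounded, being a Poisson integral of the density,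
   and by (i) the argument of G stays away from 0 and -pi, so that |G| = O(|Im G|). *)
Require Import Defs.
From HB Require Import structures.
From mathcomp Require Import all_boot all_order all_algebra.
From mathcomp Require Import all_classical all_reals all_analysis.
From mathcomp Require Import measurable_realfun.
From mathcomp Require Import ring lra.
Set Implicit Arguments.
Unset Strict Implicit.
Unset Printing Implicit Defensive.
Import Order.TTheory GRing.Theory Num.Theory.
Import numFieldNormedType.Exports.
Local Open Scope classical_set_scope.
Local Open Scope ring_scope.

(** * Lipschitz functions are primitives of their derivatives *)

Section derive1_measurable.
Context {R : realType}.
Implicit Types (f : R -> R) (x : R).

(** The transition measure is defined through an integral of [derive1 (half_diff w)], a derivative
    that exists only almost everywhere and takes a default value elsewhere. Integrating by parts
    therefore rests on differentiability almost everywhere and the fundamental theorem of calculus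
    for Lipschitz functions. Both come from Radon-Nikodym and Lebesgue differentiation: up to an
    affine change, a Lipschitz function has slopes between 0 and 1, and its Stieltjes measure is at
    most Lebesgue measure. No complex logarithm occurs: the two real equations behind
    [z G = exp (- L)] give modulus and argument of [G] directly. No improper integral of [Re G] is
    formed either: the smoothed cumulative function has derivative [- Gre] in the scale and is
    O(1/y), so it is compared with a primitive of [1 / (y (1 + y))]. Only the limit diagram is
    assumed regular. Its bound on [G] passes to a nearby diagram for [y >= e], where the ratio of
    the two moduli stays bounded. All estimates are deterministic; randomness enters through one
    inclusion of events. *)

Lemma derivable1P f x :
  derivable f x 1 <-> cvg (h^-1 *: (f (h + x) - f x) @[h --> 0^']).
Proof. by rewrite /derivable; under eq_fun do rewrite /= scaler1. Qed.

Lemma derivable1_cvg f x : derivable f x 1 ->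
  h^-1 *: (f (h + x) - f x) @[h --> 0^'] --> derive1 f x.
Proof. by move/derivable1P; exact. Qed.

(** The limit of a divergent filter is the default point, whatever [f] and [x] are. Hence [derive1]
    can be controlled also where it is not a derivative. *)
Lemma derive1_dvg : exists c : R, forall f x,
  ~ derivable f x 1 -> derive1 f x = c.
Proof. by eexists => f x nd; apply: dvgP; apply: contra_not nd; exact: (proj2 (derivable1P f x)). Qed.

(** A Cauchy criterion avoids the unknown value of the derivative, and precisions indexed by
    naturals keep the set of differentiability points within countable operations. *)
Lemma derivable1_cauchyP f x : derivable f x 1 <->
  forall k : nat, exists m : nat, forall h h', h != 0 -> h' != 0 ->
    `|h| < m.+1%:R^-1 -> `|h'| < m.+1%:R^-1 ->
    `|h^-1 * (f (h + x) - f x) - h'^-1 * (f (h' + x) - f x)| <= k.+1%:R^-1.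
Proof.
split.
  move=> /derivable1_cvg /cvgrPdist_le + k => /(_ (k.+1%:R^-1 / 2)) [].
    by rewrite divr_gt0.
  move=> e /= e0 be; near \oo => m.
  have me : m.+1%:R^-1 < e by near: m; exact: near_infty_natSinv_lt (PosNum e0).
  exists m => h h' h0 h'0 hm h'm.
  have := be h; have := be h'.
  rewrite /ball/= !sub0r !normrN (lt_trans hm)// (lt_trans h'm)//.
  move=> /(_ isT h'0) /[swap] /(_ isT h0).
  rewrite !/(_ *: _) /= => H1 H2.
  rewrite (splitr k.+1%:R^-1) -(subrKA (derive1 f x)) addrC.
  by apply: (le_trans (ler_normD _ _)); rewrite addrC lerD// distrC.
move=> H; apply/derivable1P; apply/cauchy_cvgP; apply/cauchy_ballP => e e0.
near \oo => k.
have ke : k.+1%:R^-1 < e by near: k; exact: near_infty_natSinv_lt (PosNum e0).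
have [m Hm] := H k.
have nh : \forall h \near (0:R)^', h != 0 /\ `|h| < m.+1%:R^-1.
  by near=> h; split; near: h; [exact: nbhs_dnbhs_neq|exact: dnbhs0_lt].
near_simpl; near=> h h' => /=.
rewrite -ball_normE /ball_ /=; apply: le_lt_trans ke.
have [h0 hm] : h != 0 /\ `|h| < m.+1%:R^-1 by near: h.
have [h'0 h'm] : h' != 0 /\ `|h'| < m.+1%:R^-1 by near: h'.
exact: Hm.
Unshelve. all: by end_near. Qed.

(** For fixed increments the inequality is closed in [x] by continuity. Intersecting over all
    admissible increments, an uncountable family, keeps it closed; what remains is a countable
    intersection of countable unions. *)
Lemma measurable_derivable f : continuous f ->
  measurable [set x | derivable f x 1].
Proof.
move=> cf.
pose A (h : R * R) (k : nat) := [set x | `|h.1^-1 * (f (h.1 + x) - f x)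
  - h.2^-1 * (f (h.2 + x) - f x)| <= k.+1%:R^-1].
pose C (m : nat) := [set h : R * R | [/\ h.1 != 0, h.2 != 0,
  `|h.1| < m.+1%:R^-1 & `|h.2| < m.+1%:R^-1]].
rewrite (_ : [set _ | _] = \bigcap_k \bigcup_m \bigcap_(h in C m) A h k).
  apply: bigcapT_measurable => k; apply: bigcupT_measurable => m.
  apply: closed_measurable; apply: closed_bigI => h _.
  rewrite (_ : A h k = (fun x => `|h.1^-1 * (f (h.1 + x) - f x)
    - h.2^-1 * (f (h.2 + x) - f x)|) @^-1` [set y | y <= k.+1%:R^-1])//.
  apply: closed_comp; last exact: closed_le.
  move=> x _; apply: cvg_norm; apply: cvgB.
    apply: cvgM; first exact: cvg_cst.
    apply: cvgB; last exact: cf.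
    apply: continuous_comp; last exact: cf.
    by apply: cvgD; [exact: cvg_cst|exact: cvg_id].
  apply: cvgM; first exact: cvg_cst.
  apply: cvgB; last exact: cf.
  apply: continuous_comp; last exact: cf.
  by apply: cvgD; [exact: cvg_cst|exact: cvg_id].
apply/seteqP; split => x /=.
  move/derivable1_cauchyP => H k _; have [m Hm] := H k.
  by exists m => // -[h h'] [/= h0 h'0 hm h'm]; exact: Hm.
move=> H; apply/derivable1_cauchyP => k; have [m _ Hm] := H k I.
by exists m => h h' h0 h'0 hm h'm; apply: (Hm (h, h')).
Qed.

Lemma measurable_derive1 f : continuous f -> measurable_fun setT (derive1 f).
Proof.
move=> cf; have [c derive1c] := derive1_dvg.
pose D := [set x | derivable f x 1].
have mD : measurable D by exact: measurable_derivable.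
(* Restriction to [D] puts 0 outside [D], so [c] is subtracted before and added back after: off [D]
   the sequence is constantly [c], the default value of [derive1]. *)
pose g (n : nat) : R -> R :=
  fun y => ((fun x => n.+1%:R * (f (n.+1%:R^-1 + x) - f x) - c) \_ D) y + c.
apply: (@measurable_fun_cvg _ _ _ _ g) => [n|x _].
  apply: measurable_funD => //; apply: (iffLR (measurable_restrictT _ mD)).
  apply: measurable_funB => //; apply: measurable_funTS.
  apply: continuous_measurable_fun => x.
  apply: cvgM; first exact: cvg_cst.
  apply: cvgB; last exact: cf.
  apply: continuous_comp; last exact: cf.
  by apply: cvgD; [exact: cvg_cst|exact: cvg_id].
have [Dx|nDx] := pselect (D x); last first.
  rewrite derive1c//; apply: (@cvg_trans _ (cst c @ \oo)); last exact: cvg_cst.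
  by apply: near_eq_cvg; near=> n; rewrite /g patchE memNset// add0r.
have /cvgr_dnbhsP/(_ (fun n => n.+1%:R^-1)) := derivable1_cvg (Dx : derivable f x 1).
have h0 : (forall n : nat, (n.+1%:R^-1 : R) != 0) /\
          (n.+1%:R^-1 : R) @[n --> \oo] --> (0 : R).
  by split=> [n|]; [rewrite invr_eq0 pnatr_eq0|exact: cvg_harmonic].
move=> /(_ h0); apply: cvg_trans; apply: near_eq_cvg; near=> n.
by rewrite /g patchE mem_set// invrK subrK.
Unshelve. all: by end_near. Qed.

End derive1_measurable.

(** * Stieltjes measures dominated by Lebesgue measure *)

Section stieltjes_dominated.
Context {R : realType}.
Local Notation leb := (@lebesgue_measure R).

Lemma lebesgue_stieltjes_itv_oc (f : cumulative R R) (a b : R) : a <= b ->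
  lebesgue_stieltjes_measure f `]a, b] = (f b - f a)%:E.
Proof.
move=> ab; rewrite /lebesgue_stieltjes_measure /measure_extension/=.
by rewrite measurable_mu_extE/= ?wlength_itv_bnd//; exact: is_ocitv.
Qed.

(** On half-open intervals the increments of [f] and [g] add up to the length, and this determines
    Lebesgue measure. *)
Lemma stieltjes_add (f g : cumulative R R) (A : set (measurableTypeR R)) :
  (forall x, f x + g x = x) -> measurable A ->
  leb A = (lebesgue_stieltjes_measure f A + lebesgue_stieltjes_measure g A)%E.
Proof.
move=> fg mA; rewrite -measure_addE; apply: lebesgue_measure_unique => //.
move=> X [[a b]] /= _ <-.
rewrite -[RHS]/(measure_add (lebesgue_stieltjes_measure f)
  (lebesgue_stieltjes_measure g) _) measure_addE.
have [ab|ba] := leP a b.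
  rewrite [LHS](lebesgue_stieltjes_itv_oc _ ab).
  rewrite [X in (X + _)%E](lebesgue_stieltjes_itv_oc f ab).
  rewrite [X in (_ + X)%E](lebesgue_stieltjes_itv_oc g ab).
  rewrite -EFinD; congr EFin => /=.
  by rewrite -{1}(fg a) -{1}(fg b); ring.
by rewrite set_itv_ge ?measure0 ?adde0// bnd_simp -leNgt ltW.
Qed.

Variable F : R -> R.
Hypothesis F_nd : {homo F : x y / x <= y}.
Hypothesis F_lip : forall x y, x <= y -> F y - F x <= y - x.

Let F_dist x y : `|F x - F y| <= `|x - y|.
Proof.
wlog xy : x y / x <= y.
  move=> H; case: (leP x y) => [/H //|/ltW /H]; by rewrite distrC (distrC y).
rewrite distrC (distrC x) !ger0_norm ?subr_ge0//; first exact: F_lip.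
exact: F_nd.
Qed.

Let F_cont : continuous F.
Proof.
move=> x; apply/cvgrPdist_le => e e0; near=> y.
apply: (le_trans (F_dist x y)); near: y.
by apply: cvgr_dist_le.
Unshelve. all: by end_near. Qed.

Let G x := x - F x.

Let G_nd : {homo G : x y / x <= y}.
Proof. by move=> x y xy; rewrite /G; have := F_lip xy; lra. Qed.

Let G_cont : continuous G.
Proof. by move=> x; apply: cvgB; [exact: cvg_id|exact: F_cont]. Qed.

#[local] HB.instance Definition _ :=
  isCumulative.Build R _ R F F_nd (right_continuousW F_cont).
#[local] HB.instance Definition _ :=
  isCumulative.Build R _ R G G_nd (right_continuousW G_cont).

Let muF : {measure set (measurableTypeR R) -> \bar R} :=
  lebesgue_stieltjes_measure F.

Let muF_le A : measurable A -> (muF A <= leb A)%E.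
Proof.
move=> mA; rewrite (@stieltjes_add F G)//; last first.
  by move=> x; rewrite /G addrC subrK.
by rewrite leeDl.
Qed.

(* The Stieltjes measures of [F] and [x - F] add up to Lebesgue measure, so the
   first one is absolutely continuous. *)
Lemma stieltjes_density (a b : R) : exists g : R -> R,
  leb.-integrable setT (EFin \o g) /\
  forall x y, a <= x -> x <= y -> y <= b ->
    Rintegral leb `]x, y] g = F y - F x.
Proof.
have mI : measurable (`]a, b]%classic : set (measurableTypeR R)) by [].
have Ioo : (muF `]a, b]%classic < +oo)%E.
  apply: (le_lt_trans (muF_le mI)).
  by rewrite lebesgue_measure_itv/=; case: ifP => _; rewrite ?ltry// -EFinB ltry.
have [|f [f0 ffin fint fE]] := @radon_nikodym_sigma_finite _ _ _ leb (mfrestr mI Ioo).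
  move=> A A0 B mB BA.
  apply/eqP; rewrite -measure_le0; rewrite /= /mfrestr /mrestr.
  apply: (@le_trans _ _ (muF B)); first by rewrite le_measure// inE//; exact: measurableI.
  by apply: (le_trans (muF_le mB)); rewrite (A0 _ mB BA).
exists (fine \o f).
have -> : EFin \o (fine \o f) = f by apply/funext => x /=; rewrite fineK.
split=> // x y ax xy yb; rewrite /Rintegral.
under eq_integral do rewrite /= fineK//.
rewrite -fE//= /mfrestr /mrestr setIidl; last first.
  by apply: subset_itv; rewrite bnd_simp.
by rewrite [muF _]lebesgue_stieltjes_itv_oc.
Qed.

End stieltjes_dominated.

Section derive1_slopes.
Context {R : realType}.
Implicit Types (f : R -> R) (x c e : R).

Lemma is_derive1P f x (l : R) : is_derive x 1 f l <-> derivable f x 1 /\ derive1 f x = l.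
Proof.
split=> [[df <-]|[df <-]]; first by rewrite derive1E.
by apply: DeriveDef => //; rewrite derive1E.
Qed.

Lemma derive1_ge f x c e : 0 < e -> derivable f x 1 ->
  (forall h, 0 < h -> h < e -> c * h <= f (h + x) - f x) -> c <= derive1 f x.
Proof.
move=> e0 /derivable1_cvg /cvg_dnbhs_at_right fx H.
apply: (cvgr_to_ge fx); near=> h.
have h0 : 0 < h by [].
rewrite /GRing.scale/= mulrC ler_pdivlMr//; exact: H.
Unshelve. all: by end_near. Qed.

Lemma derive1_le f x c e : 0 < e -> derivable f x 1 ->
  (forall h, 0 < h -> h < e -> f (h + x) - f x <= c * h) -> derive1 f x <= c.
Proof.
move=> e0 /derivable1_cvg /cvg_dnbhs_at_right fx H.
apply: (cvgr_to_le fx); near=> h.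
have h0 : 0 < h by [].
rewrite /GRing.scale/= mulrC ler_pdivrMr//; exact: H.
Unshelve. all: by end_near. Qed.

End derive1_slopes.

Section almost_everywhere_filter.
Context d (T : measurableType d) (R : realType) (mu : {measure set T -> \bar R}).
Implicit Types P Q S : T -> Prop.

Lemma ae_imp P Q : (forall x, P x -> Q x) ->
  {ae mu, forall x, P x} -> {ae mu, forall x, Q x}.
Proof. by move=> PQ; apply: filterS PQ; exact: ae_filter_ringOfSetsType. Qed.

Lemma ae_imp2 P Q S : (forall x, P x -> Q x -> S x) ->
  {ae mu, forall x, P x} -> {ae mu, forall x, Q x} -> {ae mu, forall x, S x}.
Proof. by move=> PQ; apply: filterS2 PQ; exact: ae_filter_ringOfSetsType. Qed.

End almost_everywhere_filter.

(** * Almost everywhere differentiability and the fundamental theorem of calculus *)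

Section lipschitz_functions.
Context {R : realType}.
Local Notation leb := (@lebesgue_measure R).
Implicit Types (f F : R -> R) (K a b : R).

Lemma lebesgue_measure_itvy a b (l r : bool) :
  (leb ([set` Interval (BSide l a) (BSide r b)] : set R) < +oo)%E.
Proof.
by rewrite lebesgue_measure_itv/=; case: ifP => _; rewrite ?ltry// -EFinB ltry.
Qed.

(** Near a point of the open interval, [F] is a constant plus the indefinite integral of its
    density, which Lebesgue's theorem differentiates almost everywhere. *)
Lemma dominated_ae_derive F a b : {homo F : x y / x <= y} ->
  (forall x y, x <= y -> F y - F x <= y - x) -> a <= b ->
  exists g : R -> R, [/\ leb.-integrable setT (EFin \o g),
    Rintegral leb `]a, b] g = F b - F a &
    {ae leb, forall x, a < x < b -> is_derive x 1 F (g x)}].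
Proof.
move=> Fnd Flip ab; have [g [gint gE]] := stieltjes_density Fnd Flip a b.
exists g; split=> //; first exact: gE.
have giy (y : R) : leb.-integrable [set` Interval (BRight a) (BRight y)] (EFin \o g).
  by apply: integrableS gint.
have := FTC1 giy (open_integrable_locally openT gint).
apply: ae_imp => x H /andP[ax xb].
have [|dH dE] := H; first by rewrite /= lte_fin.
have {}dH : is_derive x 1 (fun y => Rintegral leb `]a, y] g) (g x).
  by apply/is_derive1P.
have -> : g x = 0 + g x by rewrite add0r.
apply: (@near_eq_is_derive _ _ _ (fun y => F a + Rintegral leb `]a, y] g)).
  have /near_in_itvoo : x \in `]a, b[ by rewrite in_itv/= ax.
  apply: filterS => y; rewrite in_itv/= => /andP[ay yb].
  by rewrite gE// ?(ltW ay) ?(ltW yb)// addrC subrK.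
Qed.

Definition lip K f := forall x y, `|f x - f y| <= K * `|x - y|.

Lemma lip_continuous K f : lip K f -> continuous f.
Proof.
move=> fK x; apply/cvgrPdist_le => e e0.
have K0 : 0 <= K.
  have := fK 1 0; rewrite subr0 normr1 mulr1; exact: le_trans.
have K1 : 0 < K + 1 by rewrite ltr_wpDl.
have e1 : 0 < (e : R) / (K + 1) by exact: divr_gt0.
near=> y.
apply: (le_trans (fK x y)).
apply: (@le_trans _ _ ((K + 1) * `|x - y|)).
  by rewrite ler_wpM2r// lerDl.
rewrite mulrC -ler_pdivlMr//.
Unshelve. all: by end_near. Qed.

Lemma lip_measurable K f : lip K f -> measurable_fun setT f.
Proof. by move/lip_continuous; exact: continuous_measurable_fun. Qed.

Lemma lip_density K f a b : 0 < K -> lip K f -> a <= b ->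
  exists g : R -> R, [/\ leb.-integrable `]a, b] (EFin \o g),
    Rintegral leb `]a, b] g = f b - f a &
    {ae leb, forall x, a < x < b -> is_derive x 1 f (g x)}].
Proof.
move=> K0 fK ab.
(* The slopes of [f / K] lie in [-1, 1], hence those of [F] in [0, 1]; [f] is recovered as
   [K (2 F - x)]. *)
pose F x := (x + K^-1 * f x) / 2.
have slope x y : x <= y -> `|K^-1 * f y - K^-1 * f x| <= y - x.
  move=> xy; rewrite -mulrBr normrM gtr0_norm ?invr_gt0// mulrC ler_pdivrMr//.
  by rewrite mulrC; apply: (le_trans (fK _ _)); rewrite ger0_norm// subr_ge0.
have [] := @dominated_ae_derive F a b _ _ ab.
- by move=> x y xy; rewrite /F; have := slope _ _ xy; rewrite ler_norml; lra.
- by move=> x y xy; rewrite /F; have := slope _ _ xy; rewrite ler_norml; lra.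
move=> g [gint gE gae].
have gi : leb.-integrable `]a, b] (EFin \o g) by apply: integrableS gint.
have i1 : leb.-integrable `]a, b] (EFin \o cst (1 : R)).
  apply: measurable_bounded_integrable => //; last exact: bounded_cst.
  exact: lebesgue_measure_itvy.
have i2 : leb.-integrable `]a, b] (EFin \o (fun x => 2 * g x - 1)).
  rewrite (_ : EFin \o _ = (fun x => 2%:E * (g x)%:E - 1%:E)%E)//.
  by apply: integrableB => //; exact: integrableZl.
exists (fun x => K * (2 * g x - 1)); split.
- by under [X in _.-integrable _ X]eq_fun do rewrite /= EFinM; exact: integrableZl.
- rewrite RintegralZl// RintegralB//; last first.
    rewrite (_ : EFin \o _ = (fun x => 2%:E * (g x)%:E)%E)//.
    exact: integrableZl.
  rewrite RintegralZl// gE Rintegral_cst//.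
  have -> : fine (leb (`]a, b]%classic : set R)) = b - a.
    rewrite lebesgue_measure_itv/= lte_fin; case: ltP => [//|ba].
    by have -> : b = a; [apply/eqP; rewrite eq_le ba ab|rewrite subrr].
  by rewrite /F; field; exact: lt0r_neq0.
- apply: ae_imp gae => x H /H dF.
  have fE : f = (fun x => K * (2 * F x - x)).
    by apply/funext => y; rewrite /F; field; exact: lt0r_neq0.
  rewrite fE; apply: is_derive_eq.
  by rewrite /GRing.scale/=; ring.
Qed.

Lemma lip_ae_derivable K f : 0 < K -> lip K f -> {ae leb, forall x, derivable f x 1}.
Proof.
move=> K0 fK.
have : {ae leb, forall x, forall n : nat, - n%:R < x < n%:R -> derivable f x 1}.
  apply: ae_foralln => n.
  have [|g [_ _]] := @lip_density K f (- n%:R) n%:R K0 fK.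
    by rewrite (@le_trans _ _ 0)// oppr_le0.
  by apply: ae_imp => x H /H [].
apply: ae_imp => x H; apply: (H (Num.truncn `|x|).+1).
by rewrite -ltr_norml truncnS_gt.
Qed.

Lemma lip_derive1_bounded K f : lip K f -> exists M, forall x, `|derive1 f x| <= M.
Proof.
move=> fK; have [c cE] := @derive1_dvg R.
(* [K] bounds genuine derivatives, and [c] is the default value at the other points. *)
exists (Num.max K `|c|) => x; rewrite le_max.
have [df|ndf] := pselect (derivable f x 1); last by rewrite cE// lexx orbT.
apply/orP; left; rewrite ler_norml.
apply/andP; split; [apply: (derive1_ge ltr01)|apply: (derive1_le ltr01)] => // h h0 _.
- by have := fK (h + x) x; rewrite addrK (gtr0_norm h0) ler_norml mulNr => /andP[].
- by have := fK (h + x) x; rewrite addrK (gtr0_norm h0) ler_norml => /andP[].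
Qed.

Lemma bounded_itv_integrable f a b M : measurable_fun setT f ->
  (forall x, `|f x| <= M) -> leb.-integrable `[a, b] (EFin \o f).
Proof.
move=> mf fM; apply: measurable_bounded_integrable => //.
- exact: lebesgue_measure_itvy.
- exact: measurable_funTS.
- exists M; split; first exact: num_real.
  by move=> N MN x _; apply: (le_trans (fM x)); exact: ltW.
Qed.

Lemma lip_integrable_derive1 K f a b : lip K f ->
  leb.-integrable `[a, b] (EFin \o derive1 f).
Proof.
move=> fK; have [M HM] := lip_derive1_bounded fK.
apply: bounded_itv_integrable HM; apply: measurable_derive1.
exact: lip_continuous fK.
Qed.

(** The density of [lip_density] is the derivative almost everywhere on the open interval, and the
    endpoints are negligible. *)
Lemma lip_FTC K f a b : 0 < K -> lip K f -> a <= b ->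
  Rintegral leb `[a, b] (derive1 f) = f b - f a.
Proof.
move=> K0 fK ab; have [g [gi <- gae]] := lip_density K0 fK ab.
have fi := lip_integrable_derive1 a b fK.
have fi' : leb.-integrable `]a, b] (EFin \o derive1 f).
  by apply: integrableS fi => //; apply: subset_itvr; rewrite bnd_simp.
rewrite -(Rintegral_itv_obnd_cbnd fi').
congr fine; apply: ae_eq_integral => //.
- by case/integrableP : fi'.
- by case/integrableP : gi.
have nb : {ae leb, forall x, x != b}.
  exists [set b]; split => //; first exact: lebesgue_measure_set1.
  by move=> x /= /negP; rewrite negbK => /eqP.
apply: ae_imp2 gae nb => x H xb; rewrite /= in_itv/= => /andP[ax xb'].
have [|df dE] := H; first by rewrite ax lt_neqAle xb.
by rewrite /= derive1E dE.
Qed.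

End lipschitz_functions.

(** * The Cauchy transform near the real axis *)

Section ae_comparison.
Context d (T : measurableType d) (R : realType) (mu : {measure set T -> \bar R}).

Lemma ae_le_Rintegral (D : set T) (f g : T -> R) : measurable D ->
  mu.-integrable D (EFin \o f) -> mu.-integrable D (EFin \o g) ->
  {ae mu, forall x, D x -> f x <= g x} ->
  Rintegral mu D f <= Rintegral mu D g.
Proof.
move=> mD fi gi fg; rewrite -subr_ge0 -RintegralB//.
have mf : measurable_fun D f by apply/measurable_EFinP; exact: measurable_int fi.
have mg : measurable_fun D g by apply/measurable_EFinP; exact: measurable_int gi.
(* The positive part agrees with the difference almost everywhere and is nonnegative everywhere. *)
rewrite /Rintegral (@ae_eq_integral _ _ _ mu D (fun x => (Num.max (g x - f x) 0)%:E))//.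
- by apply: fine_ge0; apply: integral_ge0 => x _; rewrite lee_fin le_max lexx orbT.
- by apply/measurable_EFinP; exact: measurable_funB.
- by apply/measurable_EFinP; apply: measurable_maxr => //; exact: measurable_funB.
- by apply: ae_imp fg => x H Dx; rewrite max_l// subr_ge0; exact: H.
Qed.

End ae_comparison.

Section real_integrable.
Context d (T : measurableType d) (R : realType) (mu : {measure set T -> \bar R}).
Variables (D : set T) (mD : measurable D).
Implicit Types f g : T -> R.

Lemma integrable_EFinB f g : mu.-integrable D (EFin \o f) ->
  mu.-integrable D (EFin \o g) -> mu.-integrable D (EFin \o (fun x => f x - g x)).
Proof. by move=> fi gi; exact: (integrableB mD fi gi). Qed.

Lemma integrable_EFinD f g : mu.-integrable D (EFin \o f) ->
  mu.-integrable D (EFin \o g) -> mu.-integrable D (EFin \o (fun x => f x + g x)).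
Proof. by move=> fi gi; exact: (integrableD mD fi gi). Qed.

Lemma integrable_EFinZl (k : R) f : mu.-integrable D (EFin \o f) ->
  mu.-integrable D (EFin \o (fun x => k * f x)).
Proof. by move=> fi; exact: (integrableZl mD k fi). Qed.

End real_integrable.

(** * Integration by parts against Lipschitz functions *)

Section integration_by_parts.
Context {R : realType}.
Local Notation leb := (@lebesgue_measure R).
Implicit Types (f k T s : R -> R) (K a b : R).

Lemma lip_of_derive f (f' : R -> R) K :
  (forall x : R, is_derive x 1 f (f' x)) -> (forall x, `|f' x| <= K) -> lip K f.
Proof.
move=> df f'K x y.
wlog xy : x y / x < y.
  move=> H; case: (ltgtP x y) => [/H //|/H|->].
    by rewrite distrC (distrC y).
  by rewrite !subrr normr0 mulr0.
have dfi z : z \in `]x, y[ -> is_derive z 1 f (f' z) by move=> _; exact: df.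
have cf : {within `[x, y], continuous f}.
  by apply: derivable_within_continuous => z _; exact: ex_derive.
have [c _ fE] := MVT xy dfi cf.
rewrite distrC fE normrM (distrC x); exact: ler_wpM2r.
Qed.

Lemma lipM f g Kf Kg Bf Bg : lip Kf f -> lip Kg g ->
  (forall x, `|f x| <= Bf) -> (forall x, `|g x| <= Bg) ->
  lip (Bf * Kg + Kf * Bg) (fun x => f x * g x).
Proof.
move=> fK gK fB gB x y.
have -> : f x * g x - f y * g y = f x * (g x - g y) + (f x - f y) * g y by ring.
apply: (le_trans (ler_normD _ _)); rewrite !normrM mulrDl lerD//.
  by rewrite -mulrA; apply: ler_pM.
by rewrite mulrAC; apply: ler_pM.
Qed.

Lemma lipB f g Kf Kg : lip Kf f -> lip Kg g -> lip (Kf + Kg) (fun x => f x - g x).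
Proof.
move=> fK gK x y.
have -> : f x - g x - (f y - g y) = (f x - f y) - (g x - g y) by ring.
by apply: (le_trans (ler_normB _ _)); rewrite mulrDl lerD.
Qed.

(** Supplies the positive constant that [lip_FTC] and [lip_ae_derivable] require. *)
Lemma lip_weaken f K : lip K f -> lip (`|K| + 1) f.
Proof.
move=> fK x y; apply: (le_trans (fK x y)).
by rewrite ler_wpM2r// (le_trans (ler_norm _))// lerDl.
Qed.

Lemma lip_mul_derive1_integrable k s Kk Ks B a b : lip Kk k -> lip Ks s ->
  (forall x, `|k x| <= B) ->
  leb.-integrable `[a, b] (EFin \o (fun v => k v * derive1 s v)).
Proof.
move=> kK sK kB; have [M HM] := lip_derive1_bounded sK.
apply: (@bounded_itv_integrable _ _ _ _ (B * M)).
  apply: measurable_funM; first exact: lip_measurable kK.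
  by apply: measurable_derive1; exact: lip_continuous sK.
by move=> x; rewrite normrM; apply: ler_pM.
Qed.

(* Integrating [k s'] by parts costs the total variation of [k] on the
   support, here controlled by the primitive [T] of a bound of [|k'|]. *)
Lemma ibp_distance k T s1 s2 K1 K2 Kk KT (B : R) (k' T' : R -> R) (M e : R) :
  0 <= M -> lip K1 s1 -> lip K2 s2 -> s1 M = 0 -> s1 (- M) = 0 -> s2 M = 0 ->
  s2 (- M) = 0 -> (forall x, `|s1 x - s2 x| <= e) ->
  (forall x : R, is_derive x 1 k (k' x)) -> lip Kk k -> (forall x, `|k x| <= B) ->
  (forall x : R, is_derive x 1 T (T' x)) -> lip KT T ->
  (forall x, `|k' x| <= T' x) ->
  `|Rintegral leb `[- M, M] (fun v => k v * derive1 s1 v) -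
    Rintegral leb `[- M, M] (fun v => k v * derive1 s2 v)| <= e * (T M - T (- M)).
Proof.
move=> M0 s1K s2K s1M s1N s2M s2N se dk kK kB dT TK k'T'.
have i1 := lip_mul_derive1_integrable (- M) M kK s1K kB.
have i2 := lip_mul_derive1_integrable (- M) M kK s2K kB.
have MM : - M <= M by rewrite (@le_trans _ _ 0)// oppr_le0.
pose s v := s1 v - s2 v; pose f v := k v * s v.
have fK : lip (`|B * (K1 + K2) + Kk * e| + 1) f.
  exact: lip_weaken (lipM kK (lipB s1K s2K) kB se).
have pos (K : R) : 0 < `|K| + 1 by rewrite ltr_wpDl.
have TK' := lip_weaken TK.
have K1' := lip_weaken s1K.
have K2' := lip_weaken s2K.
have fE := lip_FTC (pos _) fK MM.
have TE := lip_FTC (pos _) TK' MM.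
have fi := lip_integrable_derive1 (- M) M fK.
have Ti := lip_integrable_derive1 (- M) M TK'.
(* By the product rule the difference is [- s k'], at most [e T'] in absolute value. The integral of
   [derive1 f] drops out because [f] vanishes at both ends. *)
have key : {ae leb, forall x, `|k x * derive1 s1 x - k x * derive1 s2 x - derive1 f x|
    <= e * derive1 T x}.
  apply: ae_imp2 (lip_ae_derivable (pos K1) K1') (lip_ae_derivable (pos K2) K2') => x d1 d2.
  have ds1 : is_derive x 1 s1 (derive1 s1 x) by apply/is_derive1P.
  have ds2 : is_derive x 1 s2 (derive1 s2 x) by apply/is_derive1P.
  have ds : is_derive x 1 s (derive1 s1 x - derive1 s2 x) by apply: is_deriveB.
  have df : is_derive x 1 f (k x * (derive1 s1 x - derive1 s2 x) + s x * k' x).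
    by have := is_deriveM (dk x) ds.
  have [_ ->] := (is_derive1P _ _ _).1 df.
  have [_ ->] := (is_derive1P _ _ _).1 (dT x).
  rewrite mulrBr opprD addrA subrr sub0r normrN normrM.
  by apply: ler_pM => //; exact: se.
have mI : measurable (`[- M, M]%classic : set (measurableTypeR R)) by [].
have eTi := integrable_EFinZl mI e Ti.
have di := integrable_EFinB mI i1 i2.
have up := integrable_EFinD mI fi eTi.
have dn := integrable_EFinB mI fi eTi.
have f0 : f M - f (- M) = 0 by rewrite /f /s s1M s1N s2M s2N; ring.
rewrite -RintegralB// ler_norml; apply/andP; split.
  apply: (@le_trans _ _ (Rintegral leb `[- M, M] (fun x => derive1 f x - e * derive1 T x))).
    by rewrite RintegralB// RintegralZl// fE TE f0 sub0r.
  apply: ae_le_Rintegral => //; apply: ae_imp key => x H _.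
  move: H; rewrite ler_norml => /andP[+ _].
  by rewrite lerNl opprB lerBlDr addrC -lerBlDr.
apply: (@le_trans _ _ (Rintegral leb `[- M, M] (fun x => derive1 f x + e * derive1 T x))).
  apply: ae_le_Rintegral => //; apply: ae_imp key => x H _.
  by move: H; rewrite ler_norml => /andP[_]; rewrite lerBlDl.
by rewrite RintegralD// RintegralZl// fE TE f0 add0r.
Qed.

End integration_by_parts.

(** * The Cauchy kernel and its dependence on the diagram *)

Section cauchy_kernel.
Context {R : realType}.
Implicit Types (x y v : R).

Lemma cauchy_den_gt0 x y v : 0 < y -> 0 < (x - v) ^+ 2 + y ^+ 2.
Proof. by move=> y0; rewrite ltr_wpDl ?sqr_ge0// exprn_gt0. Qed.

Lemma is_derive_cauchy_re x y v : 0 < y -> is_derive v 1 (cauchy_re x y)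
  (((x - v) ^+ 2 - y ^+ 2) / ((x - v) ^+ 2 + y ^+ 2) ^+ 2).
Proof.
move=> y0; have N0 := lt0r_neq0 (cauchy_den_gt0 x v y0); rewrite /cauchy_re.
apply: is_derive_eq; rewrite /GRing.scale/=; field; exact: N0.
Qed.

Lemma is_derive_cauchy_im x y v : 0 < y -> is_derive v 1 (cauchy_im x y)
  (- (2 * y * (x - v)) / ((x - v) ^+ 2 + y ^+ 2) ^+ 2).
Proof.
move=> y0; have N0 := lt0r_neq0 (cauchy_den_gt0 x v y0); rewrite /cauchy_im.
apply: is_derive_eq; rewrite /GRing.scale/=; field; exact: N0.
Qed.

(** In [v], a primitive of the Poisson kernel: the signed angle from the vertical under which [v] is
    seen from [x + i y]. For [y > 0], [pi / 2 + angle x y 0] is the argument of [x + i y]. *)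
Definition angle x y v := atan ((v - x) / y).

Lemma is_derive_angle x y v : 0 < y ->
  is_derive v 1 (angle x y) (y / ((x - v) ^+ 2 + y ^+ 2)).
Proof.
move=> y0; have N0 := lt0r_neq0 (cauchy_den_gt0 x v y0).
have M0 : 1 + ((v - x) / y) ^+ 2 != 0.
  by apply: lt0r_neq0; rewrite ltr_pwDl// sqr_ge0.
rewrite /angle; apply: is_derive_eq; rewrite /GRing.scale/=; field.
by have y1 := lt0r_neq0 y0; rewrite y1 N0 /=.
Qed.

End cauchy_kernel.

Section diagrams.
Context {R : realType}.
Local Notation leb := (@lebesgue_measure R).
Implicit Types (w k : R -> R) (x y v e B M : R).

Lemma cauchy_re_bound x y v : 0 < y -> `|cauchy_re x y v| <= y^-1.
Proof.
move=> y0; have N0 := cauchy_den_gt0 x v y0.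
rewrite /cauchy_re normrM normfV (gtr0_norm N0) ler_pdivrMr// -(ler_pM2l y0) mulrA.
rewrite divff ?lt0r_neq0// mul1r.
have := sqr_ge0 (`|x - v| - y); rewrite sqrrB real_normK ?num_real//.
have : 0 <= (x - v) ^+ 2 + y ^+ 2 by exact: ltW.
rewrite (mulrC y) -mulr_natl; lra.
Qed.

Lemma cauchy_im_bound x y v : 0 < y -> `|cauchy_im x y v| <= y^-1.
Proof.
move=> y0; have N0 := cauchy_den_gt0 x v y0.
rewrite /cauchy_im normrM normrN normfV (gtr0_norm N0) (gtr0_norm y0).
rewrite ler_pdivrMr// -(ler_pM2l y0) mulrA divff ?lt0r_neq0// mul1r.
by rewrite -expr2 lerDr sqr_ge0.
Qed.

(** The left side is the absolute real part of [1 / (z - v) ^ 2], whose modulus is the right side;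
    [cauchy_im_derive_le] treats the imaginary part. *)
Lemma cauchy_re_derive_le x y v : 0 < y ->
  `|((x - v) ^+ 2 - y ^+ 2) / ((x - v) ^+ 2 + y ^+ 2) ^+ 2| <=
  ((x - v) ^+ 2 + y ^+ 2)^-1.
Proof.
move=> y0; have N0 := cauchy_den_gt0 x v y0.
rewrite normrM normfV (gtr0_norm (exprn_gt0 2 N0)) ler_pdivrMr ?exprn_gt0//.
rewrite expr2 mulrA mulVf ?lt0r_neq0// mul1r ler_norml.
have := sqr_ge0 (x - v); have := sqr_ge0 y; lra.
Qed.

Lemma cauchy_im_derive_le x y v : 0 < y ->
  `|- (2 * y * (x - v)) / ((x - v) ^+ 2 + y ^+ 2) ^+ 2| <=
  ((x - v) ^+ 2 + y ^+ 2)^-1.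
Proof.
move=> y0; have N0 := cauchy_den_gt0 x v y0.
rewrite normrM normfV (gtr0_norm (exprn_gt0 2 N0)) ler_pdivrMr ?exprn_gt0//.
rewrite (expr2 (_ + _)) mulrA mulVf ?lt0r_neq0// mul1r ler_norml.
have := sqr_ge0 (x - v - y); have := sqr_ge0 (x - v + y); rewrite sqrrB sqrrD; lra.
Qed.

Lemma cauchy_den_inv_le x y v : 0 < y -> ((x - v) ^+ 2 + y ^+ 2)^-1 <= (y ^+ 2)^-1.
Proof.
move=> y0; rewrite lef_pV2 ?posrE ?exprn_gt0// ?cauchy_den_gt0//.
by rewrite lerDr sqr_ge0.
Qed.

Lemma cauchy_re_lip x y : 0 < y -> lip (y ^+ 2)^-1 (cauchy_re x y).
Proof.
move=> y0; apply: lip_of_derive (fun v => is_derive_cauchy_re x v y0) _ => v.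
by apply: (le_trans (cauchy_re_derive_le x v y0)); exact: cauchy_den_inv_le.
Qed.

Lemma cauchy_im_lip x y : 0 < y -> lip (y ^+ 2)^-1 (cauchy_im x y).
Proof.
move=> y0; apply: lip_of_derive (fun v => is_derive_cauchy_im x v y0) _ => v.
by apply: (le_trans (cauchy_im_derive_le x v y0)); exact: cauchy_den_inv_le.
Qed.

Lemma angle_lip x y : 0 < y -> lip y^-1 (angle x y).
Proof.
move=> y0; apply: lip_of_derive (fun v => is_derive_angle x v y0) _ => v.
by have := cauchy_im_bound x v y0; rewrite /cauchy_im mulNr normrN.
Qed.

Lemma angle_bounds x y v : - (pi / 2) <= angle x y v <= pi / 2.
Proof. by rewrite !ltW ?atan_gtNpi2 ?atan_ltpi2. Qed.

(** From a far point of the same sign, where [w] equals the absolute value, a 1-Lipschitz function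
    cannot fall below it. *)
Lemma diagram_ge_abs w v : continual_diagram w -> `|v| <= w v.
Proof.
case=> _ wlip [C wC].
have [v0|v0] := leP 0 v.
  pose z := Num.max C v.
  have zv : v <= z by rewrite /z le_max lexx orbT.
  have wz : w z = z.
    by rewrite wC ger0_norm ?(le_trans v0)// /z le_max lexx.
  have := wlip z v; rewrite wz (ger0_norm v0) (ger0_norm (_ : 0 <= z - v)) ?subr_ge0//.
  by rewrite ler_norml; lra.
pose z := Num.min (- C) v.
have zv : z <= v by rewrite /z ge_min lexx orbT.
have z0 : z < 0 by exact: le_lt_trans v0.
have wz : w z = - z.
  by rewrite wC ltr0_norm// lerNr /z ge_min lexx.
have := wlip z v; rewrite wz (ltr0_norm v0) (ler0_norm (_ : z - v <= 0)) ?subr_le0//.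
by rewrite ler_norml; lra.
Qed.

Lemma half_diff_lip w : continual_diagram w -> lip 1 (half_diff w).
Proof.
case=> _ wlip _ x y; rewrite mul1r /half_diff.
have -> : (w x - `|x|) / 2 - (w y - `|y|) / 2 =
   ((w x - w y) - (`|x| - `|y|)) / 2 by field.
rewrite normrM normfV (gtr0_norm (_ : 0 < 2 :> R))// ler_pdivrMr//.
apply: (le_trans (ler_normB _ _)); rewrite mulr2n mulrDr mulr1 lerD//.
exact: ler_dist_dist.
Qed.

Lemma half_diff_support w : continual_diagram w ->
  exists M, 0 < M /\ forall v, M <= `|v| -> half_diff w v = 0.
Proof.
case=> _ _ [C wC]; exists (`|C| + 1); split; first by rewrite ltr_wpDl.
move=> v Mv; rewrite /half_diff wC ?subrr ?mul0r//.
by apply: (le_trans _ Mv); rewrite (le_trans (ler_norm _))// lerDl.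
Qed.

Lemma derive1_half_diff_out w M v :
  (forall v, M <= `|v| -> half_diff w v = 0) -> M < `|v| ->
  derive1 (half_diff w) v = 0.
Proof.
move=> wM Mv; have : is_derive v 1 (cst 0 : R -> R) 0 by exact: is_derive_cst.
move/(@near_eq_is_derive _ _ _ _ (half_diff w)) => H.
have : is_derive v 1 (half_diff w) 0.
  apply: H; have : \forall z \near v, M < `|z|.
    have /cvgr_gt : (fun z : R => `|z|) @ v --> `|v| by apply: cvg_norm; exact: cvg_id.
    exact.
  by apply: filterS => z Mz; rewrite wM// ltW.
by move/is_derive1P => [].
Qed.

Lemma half_diff_integral_itv w k M :
  (forall v, M <= `|v| -> half_diff w v = 0) ->
  Rintegral leb setT (fun v => k v * derive1 (half_diff w) v) =
  Rintegral leb `[- M, M] (fun v => k v * derive1 (half_diff w) v).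
Proof.
move=> wM; rewrite [RHS]Rintegral_mkcond; congr Rintegral.
apply/funext => v; rewrite patchE; case: ifPn => //.
rewrite notin_setE/= in_itv/= -ler_norml => /negP; rewrite -ltNge => Mv.
by rewrite (derive1_half_diff_out wM Mv) mulr0.
Qed.

Lemma half_diff_ibp w1 w2 k (k' : R -> R) Kk B x y e :
  continual_diagram w1 -> continual_diagram w2 ->
  (forall v, `|w1 v - w2 v| <= e) -> 0 < y ->
  (forall v : R, is_derive v 1 k (k' v)) -> lip Kk k -> (forall v, `|k v| <= B) ->
  (forall v, `|k' v| <= ((x - v) ^+ 2 + y ^+ 2)^-1) ->
  `|Rintegral leb setT (fun v => k v * derive1 (half_diff w1) v) -
    Rintegral leb setT (fun v => k v * derive1 (half_diff w2) v)| <=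
  e * pi / (2 * y).
Proof.
move=> d1 d2 w12 y0 dk kK kB k'le.
have [M1 [M10 H1]] := half_diff_support d1.
have [M2 [M20 H2]] := half_diff_support d2.
pose M := M1 + M2.
have M0 : 0 <= M by rewrite addr_ge0// ltW.
have H1' v : M <= `|v| -> half_diff w1 v = 0.
  by move=> Mv; apply: H1; apply: le_trans Mv; rewrite lerDl ltW.
have H2' v : M <= `|v| -> half_diff w2 v = 0.
  by move=> Mv; apply: H2; apply: le_trans Mv; rewrite lerDr ltW.
rewrite (half_diff_integral_itv _ H1') (half_diff_integral_itv _ H2').
have yn := lt0r_neq0 y0.
(* Its total increase is at most [pi / y], and the half-differences are within [e / 2]: this yields
   [e * pi / (2 * y)]. *)
pose T v := y^-1 * angle x y v.
have dT (v : R) : is_derive v 1 T ((x - v) ^+ 2 + y ^+ 2)^-1.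
  have := is_derive_angle x v y0 => da.
  rewrite /T; apply: is_derive_eq; rewrite /GRing.scale/=.
  by rewrite mulrA mulVf// mul1r.
have TK : lip (y ^+ 2)^-1 T.
  apply: lip_of_derive dT _ => v; rewrite ger0_norm; first exact: cauchy_den_inv_le.
  by rewrite invr_ge0 ltW// cauchy_den_gt0.
have se v : `|half_diff w1 v - half_diff w2 v| <= e / 2.
  have -> : half_diff w1 v - half_diff w2 v = (w1 v - w2 v) / 2.
    by rewrite /half_diff; field.
  by rewrite normrM normfV (gtr0_norm (_ : 0 < 2 :> R))// ler_pM2r ?invr_gt0.
have MM : M <= `|M| by exact: ler_norm.
have NM : M <= `|- M| by rewrite normrN.
have := ibp_distance M0 (half_diff_lip d1) (half_diff_lip d2) (H1' _ MM)
  (H1' _ NM) (H2' _ MM) (H2' _ NM) se dk kK kB dT TK k'le.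
move=> /le_trans; apply; rewrite /T -mulrBr.
have e0 : 0 <= e by apply: le_trans (w12 0).
have -> : e * pi / (2 * y) = e / 2 * (y^-1 * pi) by field.
rewrite ler_wpM2l ?divr_ge0// ler_wpM2l ?invr_ge0 ?(ltW y0)//.
have /andP[_ a1] := angle_bounds x y M; have /andP[a2 _] := angle_bounds x y (- M).
by lra.
Qed.

Lemma Lre_dist w1 w2 x y e : continual_diagram w1 -> continual_diagram w2 ->
  (forall v, `|w1 v - w2 v| <= e) -> 0 < y ->
  `|Lre w1 x y - Lre w2 x y| <= e * pi / (2 * y).
Proof.
move=> d1 d2 w12 y0; apply: (half_diff_ibp d1 d2 w12 y0
  (fun v => is_derive_cauchy_re x v y0) (cauchy_re_lip x y0)
  (fun v => cauchy_re_bound x v y0)) => v.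
exact: cauchy_re_derive_le.
Qed.

Lemma Lim_dist w1 w2 x y e : continual_diagram w1 -> continual_diagram w2 ->
  (forall v, `|w1 v - w2 v| <= e) -> 0 < y ->
  `|Lim_ w1 x y - Lim_ w2 x y| <= e * pi / (2 * y).
Proof.
move=> d1 d2 w12 y0; apply: (half_diff_ibp d1 d2 w12 y0
  (fun v => is_derive_cauchy_im x v y0) (cauchy_im_lip x y0)
  (fun v => cauchy_im_bound x v y0)) => v.
exact: cauchy_im_derive_le.
Qed.

End diagrams.

(** * The argument of the Cauchy transform *)

Section boundary_argument.
Context {R : realType}.
Local Notation leb := (@lebesgue_measure R).
Implicit Types (w k : R -> R) (x y v e c a b delta : R).

(** To the right of [v > 0] the absolute value has slope exactly 1, and the slopes of [w] lie in
    [[-c, c]]. *)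
Lemma half_diff_derive1_pos w v c e : 0 < e -> derivable (half_diff w) v 1 ->
  0 < v -> (forall h : R, 0 < h -> h < e -> `|w (h + v) - w v| <= c * h) ->
  - (1 + c) / 2 <= derive1 (half_diff w) v <= (c - 1) / 2.
Proof.
move=> e0 dw v0 H; apply/andP; split;
  [apply: (derive1_ge e0 dw)|apply: (derive1_le e0 dw)] => h h0 he;
  have := H h h0 he; rewrite ler_norml => /andP[H1 H2];
  rewrite /half_diff (gtr0_norm v0) gtr0_norm ?addr_gt0//; lra.
Qed.

Lemma half_diff_derive1_neg w v c e : 0 < e -> derivable (half_diff w) v 1 ->
  v < 0 -> (forall h : R, 0 < h -> h < e -> `|w (h + v) - w v| <= c * h) ->
  (1 - c) / 2 <= derive1 (half_diff w) v <= (1 + c) / 2.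
Proof.
move=> e0 dw v0 H.
(* Increments below [- v] stay on the negative side, where the absolute value has slope -1. *)
have e1 : 0 < Num.min e (- v) by rewrite lt_min e0 oppr_gt0.
apply/andP; split;
  [apply: (derive1_ge e1 dw)|apply: (derive1_le e1 dw)] => h h0;
  rewrite lt_min => /andP[he hv];
  have := H h h0 he; rewrite ler_norml => /andP[H1 H2];
  have hv0 : h + v < 0 by [lra];
  rewrite /half_diff (ltr0_norm v0) (ltr0_norm hv0); lra.
Qed.

Lemma integrable_patch_itv (f : R -> R) M (p q p' q' : R) :
  measurable_fun setT f -> (forall x, `|f x| <= M) -> 0 <= M ->
  leb.-integrable `[p, q] (EFin \o (f \_ `[p', q'])).
Proof.
move=> mf fM M0; apply: (@bounded_itv_integrable _ _ _ _ M).
  apply: (iffLR (measurable_restrictT _ _)) => //; exact: measurable_funTS.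
by move=> x; rewrite patchE; case: ifPn => // _; rewrite normr0.
Qed.

(* The argument of the Cauchy transform of [w] at [x + i y] is
   [- pi / 2 - (Lim_ w x y + angle x y 0)]; the Lipschitz constant of [w] on
   [[a, b]] keeps it away from [0] and [- pi]. *)
Lemma Lim_angle w a b delta x y : continual_diagram w -> a < b -> 0 < delta ->
  (forall z1 z2, z1 \in `[a, b] -> z2 \in `[a, b] ->
     `|w z1 - w z2| <= (1 - delta) * `|z1 - z2|) -> 0 < y ->
  `|Lim_ w x y + angle x y 0| <=
    pi / 2 - delta / 2 * (angle x y b - angle x y a).
Proof.
move=> dw ab delta0 wab y0.
have [M1 [M10 H1]] := half_diff_support dw.
pose M := M1 + `|a| + `|b|.
have M0 : 0 < M by rewrite /M; have := normr_ge0 a; have := normr_ge0 b; lra.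
have H1' v : M <= `|v| -> half_diff w v = 0.
  by move=> Mv; apply: H1; apply: le_trans Mv; rewrite /M; have := normr_ge0 a; have := normr_ge0 b; lra.
have aM : - M <= a by rewrite /M; have := normr_ge0 b; have := ler_norm (- a); rewrite normrN; lra.
have bM : b <= M by rewrite /M; have := normr_ge0 a; have := ler_norm b; lra.
rewrite /Lim_ (half_diff_integral_itv _ H1').
pose t := derive1 (angle x y).
have tE v : t v = - cauchy_im x y v.
  rewrite /t.
  have [_ ->] := iffLR (is_derive1P _ _ _) (is_derive_angle x v y0).
  by rewrite /cauchy_im mulNr opprK.
have t0 v : 0 <= t v.
  by rewrite tE /cauchy_im mulNr opprK divr_ge0 ?ltW// cauchy_den_gt0.
have tB v : `|t v| <= y^-1 by rewrite tE normrN; exact: cauchy_im_bound.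
have yV0 : 0 < y^-1 by rewrite invr_gt0.
have aL := angle_lip x y0.
have mt : measurable_fun setT t by apply: measurable_derive1; exact: lip_continuous aL.
have FTC p q : p <= q -> Rintegral leb `[p, q] t = angle x y q - angle x y p.
  by move=> pq; rewrite (lip_FTC yV0 aL pq).
have patchFTC p q : - M <= p -> p <= q -> q <= M ->
    Rintegral leb `[- M, M] (t \_ `[p, q]) = angle x y q - angle x y p.
  move=> Mp pq qM; rewrite -FTC// -Rintegral_mkcondr; congr Rintegral.
  by rewrite setIidr//; apply: subset_itv; rewrite bnd_simp.
have ti p q : leb.-integrable `[- M, M] (EFin \o (t \_ `[p, q])).
  exact: integrable_patch_itv mt tB (ltW yV0).
have dti : leb.-integrable `[- M, M] (EFin \o (fun v => delta / 2 * (t \_ `[a, b]) v)).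
  exact: integrable_EFinZl.
have ki : leb.-integrable `[- M, M]
    (EFin \o (fun v => cauchy_im x y v * derive1 (half_diff w) v)).
  apply: lip_mul_derive1_integrable (cauchy_im_lip x y0) (half_diff_lip dw) _.
  by move=> v; exact: cauchy_im_bound.
have upi : leb.-integrable `[- M, M]
    (EFin \o (fun v => (t \_ `[0, M]) v - delta / 2 * (t \_ `[a, b]) v)).
  exact: integrable_EFinB.
have dni : leb.-integrable `[- M, M]
    (EFin \o (fun v => delta / 2 * (t \_ `[a, b]) v - (t \_ `[- M, 0]) v)).
  exact: integrable_EFinB.
have nz (z : R) : {ae leb, forall v, v != z}.
  exists [set z]; split => //; first exact: lebesgue_measure_set1.
  by move=> v /= /negP; rewrite negbK => /eqP.
(* The derivative of [half_diff w] lies in [-1, 0] for [v > 0] and in [0, 1] for [v < 0]. On []a,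
   b[] the smaller Lipschitz constant moves both ends of this range inwards by [delta / 2]. *)
have key : {ae leb, forall v, `[- M, M]%classic v ->
    delta / 2 * (t \_ `[a, b]) v - (t \_ `[- M, 0]) v <=
    cauchy_im x y v * derive1 (half_diff w) v <=
    (t \_ `[0, M]) v - delta / 2 * (t \_ `[a, b]) v}.
  have nzab : {ae leb, forall v, v != a /\ v != b}.
    by apply: ae_imp2 (nz a) (nz b) => v; exact: conj.
  have nz0ab : {ae leb, forall v, v != 0 /\ (v != a /\ v != b)}.
    by apply: ae_imp2 (nz 0) nzab => v; exact: conj.
  apply: ae_imp2 (lip_ae_derivable ltr01 (half_diff_lip dw)) nz0ab => v dv [v0 [va vb]].
  rewrite /= in_itv/= => /andP[Mv vM].
  pose c := if a < v < b then 1 - delta else 1.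
  have [e [e0 slope]] : exists e : R, 0 < e /\
      forall h : R, 0 < h -> h < e -> `|w (h + v) - w v| <= c * h.
    rewrite /c; case: ifPn => [/andP[av vb']|_].
      exists (b - v); rewrite subr_gt0; split=> // h h0 hb.
      rewrite (_ : h = `|h + v - v|); last by rewrite addrK gtr0_norm.
      rewrite {1}addrK (gtr0_norm h0).
      by apply: wab; rewrite in_itv/=; apply/andP; split; lra.
    exists 1; split=> // h h0 _; case: dw => _ /(_ (h + v) v) + _.
    by rewrite addrK (gtr0_norm h0) mul1r.
  have kE : cauchy_im x y v = - t v by rewrite tE opprK.
  have pE : (t \_ `[a, b]) v = (if a < v < b then 1 else 0) * t v.
    rewrite patchE; case: ifPn.
      rewrite inE/= in_itv/= !le_eqVlt ![a == v]eq_sym (negPf va) (negPf vb)/= => ->.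
      by rewrite mul1r.
    rewrite notin_setE/= in_itv/= => nab; case: ifPn => [/andP[av vb']|]; last by rewrite mul0r.
    by case: nab; rewrite (ltW av) (ltW vb').
  rewrite pE kE.
  have [v_gt0|v_lt0|v_eq0] := ltgtP 0 v.
  - have /andP[L U] := half_diff_derive1_pos e0 dv v_gt0 slope.
    rewrite patchE memNset; last by rewrite /= in_itv/= => /andP[_]; rewrite leNgt v_gt0.
    (* Outside its interval a patched function takes the default point, which is 0. *)
    rewrite -[point]/(0 : R).
    rewrite patchE mem_set; last by rewrite /= in_itv/= (ltW v_gt0).
    move: L U; rewrite /c; case: ifP => _ L U; apply/andP; split; rewrite -subr_ge0.
    + have := mulr_ge0 (t0 v) (_ : 0 <= - derive1 (half_diff w) v - delta / 2); lra.
    + have := mulr_ge0 (t0 v) (_ : 0 <= 1 - delta / 2 + derive1 (half_diff w) v); lra.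
    + have := mulr_ge0 (t0 v) (_ : 0 <= - derive1 (half_diff w) v); lra.
    + have := mulr_ge0 (t0 v) (_ : 0 <= 1 + derive1 (half_diff w) v); lra.
  - have /andP[L U] := half_diff_derive1_neg e0 dv v_lt0 slope.
    rewrite patchE mem_set; last by rewrite /= in_itv/= Mv (ltW v_lt0).
    rewrite patchE memNset; last by rewrite /= in_itv/= => /andP[]; rewrite leNgt v_lt0.
    rewrite -[point]/(0 : R).
    move: L U; rewrite /c; case: ifP => _ L U; apply/andP; split; rewrite -subr_ge0.
    + have := mulr_ge0 (t0 v) (_ : 0 <= 1 - delta / 2 - derive1 (half_diff w) v); lra.
    + have := mulr_ge0 (t0 v) (_ : 0 <= derive1 (half_diff w) v - delta / 2); lra.
    + have := mulr_ge0 (t0 v) (_ : 0 <= 1 - derive1 (half_diff w) v); lra.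
    + have := mulr_ge0 (t0 v) (_ : 0 <= derive1 (half_diff w) v); lra.
  - by move: v0; rewrite -v_eq0 eqxx.
have NM0 : - M <= 0 by rewrite oppr_le0 ltW.
have lo : delta / 2 * (angle x y b - angle x y a) - (angle x y 0 - angle x y (- M)) <=
    Rintegral leb `[- M, M] (fun v => cauchy_im x y v * derive1 (half_diff w) v).
  have <- : Rintegral leb `[- M, M]
      (fun v => delta / 2 * (t \_ `[a, b]) v - (t \_ `[- M, 0]) v) =
      delta / 2 * (angle x y b - angle x y a) - (angle x y 0 - angle x y (- M)).
    by rewrite RintegralB// RintegralZl// !patchFTC// ltW.
  apply: ae_le_Rintegral => //.
  by apply: ae_imp key => v H /H /andP[].
have up : Rintegral leb `[- M, M] (fun v => cauchy_im x y v * derive1 (half_diff w) v) <=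
    (angle x y M - angle x y 0) - delta / 2 * (angle x y b - angle x y a).
  have <- : Rintegral leb `[- M, M]
      (fun v => (t \_ `[0, M]) v - delta / 2 * (t \_ `[a, b]) v) =
      (angle x y M - angle x y 0) - delta / 2 * (angle x y b - angle x y a).
    by rewrite RintegralB// RintegralZl// !patchFTC// ltW.
  apply: ae_le_Rintegral => //.
  by apply: ae_imp key => v H /H /andP[].
(* Adding [angle x y 0] cancels it in [lo] and [up]; only the angles at [M] and [- M] remain. *)
have /andP[_ a1] := angle_bounds x y M; have /andP[a2 _] := angle_bounds x y (- M).
rewrite ler_norml; apply/andP; split; lra.
Qed.

End boundary_argument.

Section measure_comparison.
Context d (T : measurableType d) (R : realType).
Import HBNNSimple.

(** A nonnegative simple function below [f] restricted to [S] vanishes off [S], so its level sets of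
    nonzero value lie in [S], where the measures are compared. *)
Lemma ge0_le_measure_integral_on (m1 m2 : {measure set T -> \bar R}) (S : set T)
    (f : T -> \bar R) : measurable S ->
  (forall A, measurable A -> A `<=` S -> (m1 A <= m2 A)%E) ->
  (forall x, S x -> (0 <= f x)%E) ->
  (\int[m1]_(x in S) f x <= \int[m2]_(x in S) f x)%E.
Proof.
move=> mS m12 f0; rewrite !ge0_integralE //= ge_ereal_sup// => _ [h/= hfS] <-.
apply: le_ereal_sup_tmp; exists (sintegral m2 h); first by exists h.
rewrite !sintegralE lee_fsum// => r [t _ <-].
have [ht0|ht0] := eqVneq (h t) 0; first by rewrite ht0 !mul0e.
apply: lee_wpmul2l; first by rewrite lee_fin.
apply: m12 => // x /= hx.
apply/not_notP => nSx; have := hfS x; rewrite patchE memNset// hx lee_fin => ht.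
by move: ht0; rewrite eq_le ht fun_ge0.
Qed.

End measure_comparison.

Section probability_integrals.
Context d (T : measurableType d) (R : realType) (P : probability T R).
Implicit Types (f g : T -> R) (M : R).

Lemma bounded_integrable_prob f M : measurable_fun setT f ->
  (forall x, `|f x| <= M) -> P.-integrable setT (EFin \o f).
Proof.
move=> mf fM; apply: measurable_bounded_integrable => //.
  by apply: (@le_lt_trans _ _ 1%E); [exact: probability_le1|exact: ltry].
exists M; split; first exact: num_real.
by move=> N MN x _; apply: (le_trans (fM x)); exact: ltW.
Qed.

Lemma Rintegral_prob_cst M : Rintegral P setT (fun=> M) = M.
Proof.
rewrite Rintegral_cst// -[RHS]mulr1; congr (_ * _).
by rewrite -[RHS]/(fine 1%E); congr fine; exact: probability_setT.
Qed.

(** [B] provides integrability; the almost sure bound [M] gives the estimate and may come from the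
    support of [P]. *)
Lemma ae_Rintegral_prob_bound f M B : measurable_fun setT f ->
  (forall x, `|f x| <= B) -> {ae P, forall x, `|f x| <= M} ->
  `|Rintegral P setT f| <= M.
Proof.
move=> mf fB fM; have fi := bounded_integrable_prob mf fB.
have ci N : P.-integrable setT (EFin \o fun=> N).
  by apply: (@bounded_integrable_prob _ `|N|).
rewrite ler_norml; apply/andP; split;
  [rewrite -[leLHS]Rintegral_prob_cst|rewrite -[leRHS]Rintegral_prob_cst];
  by apply: ae_le_Rintegral => //; apply: ae_imp fM => x;
  rewrite ler_norml => /andP[].
Qed.

Lemma Rintegral_prob_bound f M : measurable_fun setT f ->
  (forall x, `|f x| <= M) -> `|Rintegral P setT f| <= M.
Proof. by move=> mf fM; apply: ae_Rintegral_prob_bound fM (aeW _ fM). Qed.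

End probability_integrals.

(** * Size and polar form of the Cauchy transform *)

Section cauchy_transform.
Context {R : realType}.
Local Notation leb := (@lebesgue_measure R).
Implicit Types (mu : probability R R) (w : R -> R) (x y a b m C delta : R).

(* [probability R R] and [lebesgue_measure] live on two copies of the Borel
   structure of [R]; the identity pushes the former onto the latter. *)
Let idTR : R -> measurableTypeR R := idfun.

#[local] HB.instance Definition _ :=
  @isMeasurableFun.Build _ _ _ _ idTR (@measurable_id _ _ setT).

Lemma density_integral_le mu (D : set R) C (f : R -> R) : measurable D ->
  0 <= C -> measurable_fun setT f -> (forall x, 0 <= f x) ->
  (forall A, measurable A -> A `<=` D -> (mu A <= C%:E * leb A)%E) ->
  (\int[mu]_(v in D) (f v)%:E <= C%:E * \int[leb]_(v in D) (f v)%:E)%E.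
Proof.
move=> mD C0 mf f0 muC.
have mfD : measurable_fun D (EFin \o f).
  by apply/measurable_EFinP; exact: measurable_funTS.
have -> : (\int[mu]_(v in D) (f v)%:E = \int[pushforward mu idTR]_(v in D) (f v)%:E)%E.
  by rewrite ge0_integral_pushforward// => v _; rewrite lee_fin.
rewrite -(@ge0_integral_mscale _ _ _ leb _ mD (NngNum C0))//; last first.
  by move=> v _; rewrite lee_fin.
apply: ge0_le_measure_integral_on => //; last by move=> v _; rewrite lee_fin.
Qed.

Lemma measurable_cauchy_re x y : 0 < y -> measurable_fun setT (cauchy_re x y).
Proof. by move=> y0; exact: lip_measurable (cauchy_re_lip x y0). Qed.

Lemma measurable_cauchy_im x y : 0 < y -> measurable_fun setT (cauchy_im x y).
Proof. by move=> y0; exact: lip_measurable (cauchy_im_lip x y0). Qed.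

Lemma Gre_bound mu x y : 0 < y -> `|Gre mu x y| <= y^-1.
Proof.
move=> y0; apply: Rintegral_prob_bound; first exact: measurable_cauchy_re.
by move=> v; exact: cauchy_re_bound.
Qed.

Lemma Gim_bound mu x y : 0 < y -> `|Gim mu x y| <= y^-1.
Proof.
move=> y0; apply: Rintegral_prob_bound; first exact: measurable_cauchy_im.
by move=> v; exact: cauchy_im_bound.
Qed.

(* The part of [mu] away from [x] contributes at most [y / m ^ 2], the rest is
   compared with the Poisson kernel integrated against [C] times Lebesgue. *)
Lemma Gim_density mu x y a b m C : 0 < y -> 0 < m -> a <= x - m -> x + m <= b ->
  0 <= C ->
  (forall A, measurable A -> A `<=` `[a, b]%classic -> (mu A <= C%:E * leb A)%E) ->
  - Gim mu x y <= C * pi + y / m ^+ 2.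
Proof.
move=> y0 m0 ax xb C0 muC.
pose f v := - cauchy_im x y v.
have f0 v : 0 <= f v.
  by rewrite /f /cauchy_im mulNr opprK divr_ge0 ?ltW// cauchy_den_gt0.
have mf : measurable_fun setT f.
  rewrite (_ : f = (fun v => 0 - cauchy_im x y v)).
    by apply: measurable_funB => //; exact: measurable_cauchy_im.
  by apply/funext => v; rewrite sub0r.
have fB v : `|f v| <= y^-1 by rewrite normrN; exact: cauchy_im_bound.
have fi := bounded_integrable_prob mu mf fB.
have mI : measurable (`[a, b]%classic : set R) by [].
have fI : mu.-integrable `[a, b] (EFin \o f) by apply: integrableS fi.
have fIc : mu.-integrable (~` `[a, b]) (EFin \o f).
  by apply: integrableS fi => //; exact: measurableC.
have -> : - Gim mu x y = Rintegral mu setT f.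
  have -> : f = (fun v => - 1 * cauchy_im x y v).
    by apply/funext => v; rewrite /f mulN1r.
  rewrite RintegralZl// ?mulN1r//.
  apply: (bounded_integrable_prob mu _ (fun v => cauchy_im_bound x v y0)).
  exact: measurable_cauchy_im.
rewrite -(setUv `[a, b]%classic) Rintegral_setU//; last 3 first.
- exact: measurableC.
- by rewrite setUv.
- by apply/disj_set2P; rewrite setICr.
apply: lerD.
  have le1 : (\int[mu]_(v in `[a, b]) (f v)%:E <=
      C%:E * \int[leb]_(v in `[a, b]) (f v)%:E)%E.
    exact: density_integral_le.
  have ti : Rintegral leb `[a, b] f <= pi.
    have aL := angle_lip x y0.
    have yV0 : 0 < y^-1 by rewrite invr_gt0.
    have -> : f = derive1 (angle x y).
      apply/funext => v; rewrite (iffLR (is_derive1P _ _ _) (is_derive_angle x v y0)).2.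
      by rewrite /f /cauchy_im mulNr opprK.
    rewrite (lip_FTC yV0 aL); last by lra.
    have /andP[_ a1] := angle_bounds x y b; have /andP[a2 _] := angle_bounds x y a.
    by lra.
  have fl : leb.-integrable `[a, b] (EFin \o f) by exact: bounded_itv_integrable fB.
  apply: (@le_trans _ _ (C * Rintegral leb `[a, b] f)); last exact: ler_wpM2l.
  rewrite /Rintegral -lee_fin EFinM !fineK//; first exact: integrable_fin_num fl.
  exact: integrable_fin_num fI.
have bi : mu.-integrable (~` `[a, b]) (EFin \o (fun=> y / m ^+ 2)).
  apply: (@integrableS _ _ _ _ setT) => //; first exact: measurableC.
  by apply: (@bounded_integrable_prob _ _ _ mu _ `|y / m ^+ 2|).
apply: (@le_trans _ _ (Rintegral mu (~` `[a, b]) (fun=> y / m ^+ 2))).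
  apply: le_Rintegral => //; first exact: measurableC.
  move=> v /= /negP; rewrite in_itv/= negb_and -!ltNge => vab.
  rewrite /f /cauchy_im mulNr opprK ler_pM2l// lef_pV2 ?posrE ?exprn_gt0 ?cauchy_den_gt0//.
  rewrite ler_wpDr ?sqr_ge0// -(real_normK (num_real (x - v))).
  rewrite lerXn2r ?nnegrE ?normr_ge0 ?(ltW m0)//.
  by rewrite ler_normr; case/orP: vab => H; apply/orP; [left|right]; lra.
have mIc : measurable (~` `[a, b]%classic : set R) by exact: measurableC.
rewrite Rintegral_cst// ler_piMr//; first by rewrite divr_ge0 ?exprn_ge0 ?(ltW m0) ?(ltW y0).
by rewrite -lee_fin fineK; [exact: probability_le1|exact: fin_num_measure].
Qed.

(** For [y > 0] this is [|exp (- L)| / |z|], since [cos (angle x y 0) = y / |z|] for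
    [z = x + i y]. *)
Definition cauchy_modulus w x y := expR (- Lre w x y) * (cos (angle x y 0) / y).

Lemma cauchy_modulus_gt0 w x y : 0 < y -> 0 < cauchy_modulus w x y.
Proof.
move=> y0; rewrite mulr_gt0 ?expR_gt0// divr_gt0//.
by apply: cos_gt0_pihalf; rewrite atan_gtNpi2 atan_ltpi2.
Qed.

(* Solving [(x + i y) G = exp (- L)] for [G] in polar form. *)
Lemma cauchy_polar w mu x y : transition_measure w mu -> 0 < y ->
  Gre mu x y = - (cauchy_modulus w x y * sin (Lim_ w x y + angle x y 0)) /\
  Gim mu x y = - (cauchy_modulus w x y * cos (Lim_ w x y + angle x y 0)).
Proof.
move=> [_ wmu] y0; have [E1 E2] := wmu x y (lt0r_neq0 y0).
pose T := angle x y 0.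
have c0 : 0 < cos T.
  by apply: cos_gt0_pihalf; rewrite atan_gtNpi2 atan_ltpi2.
have cn := lt0r_neq0 c0.
have tT : tan T = - x / y by rewrite /T /angle atanK sub0r.
have yn := lt0r_neq0 y0.
(* [rho] is [|z|], and [z = rho (- sin T + i cos T)]. *)
pose rho := y / cos T.
have rho0 : 0 < rho by rewrite divr_gt0.
have yE : y = rho * cos T by rewrite /rho divfK.
have xE : x = - (rho * sin T).
  have : sin T = - x / y * cos T by rewrite -tT /tan divfK.
  by move=> ->; rewrite /rho; field; rewrite cn yn.
have cs : cos T * cos T + sin T * sin T = 1 by rewrite -!expr2 cos2Dsin2.
pose E := expR (- Lre w x y); have E0 : 0 < E by exact: expR_gt0.
have -> : cauchy_modulus w x y = E / rho.
  by rewrite /cauchy_modulus -/T -/E /rho; field; rewrite cn yn.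
rewrite -/T sinD cosD; move: E1 E2; rewrite -/E.
set g := Gre mu x y; set h := Gim mu x y.
set L := Lim_ w x y.
rewrite xE yE => E1 E2.
have rn := lt0r_neq0 rho0.
have A1 : rho * g = - (E * (sin L * cos T + cos L * sin T)).
  transitivity (rho * g * (cos T * cos T + sin T * sin T)); first by rewrite cs mulr1.
  transitivity ((- (rho * sin T) * g - rho * cos T * h) * - sin T +
    (- (rho * sin T) * h + rho * cos T * g) * cos T); first by ring.
  by rewrite E1 E2; ring.
have A2 : rho * h = - (E * (cos L * cos T - sin L * sin T)).
  transitivity (rho * h * (cos T * cos T + sin T * sin T)); first by rewrite cs mulr1.
  transitivity ((- (rho * sin T) * g - rho * cos T * h) * - cos T +
    (- (rho * sin T) * h + rho * cos T * g) * - sin T); first by ring.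
  by rewrite E1 E2; ring.
split; apply: (mulfI rn); [rewrite A1|rewrite A2]; field; exact: rn.
Qed.

End cauchy_transform.

Section cauchy_transform_estimates.
Context {R : realType}.
Local Notation leb := (@lebesgue_measure R).
Implicit Types (mu : probability R R) (w : R -> R).
Implicit Types (x y a b m C B delta e t u : R).

Lemma atan_le_id u : 0 <= u -> `|atan u| <= u.
Proof.
move=> u0; have aL : lip 1 (@atan R).
  apply: (lip_of_derive (fun x => is_derive1_atan x)) => x.
  have x1 : 1 <= 1 + x ^+ 2 by rewrite lerDl sqr_ge0.
  by rewrite gtr0_norm ?invr_gt0 ?(lt_le_trans ltr01)// invf_le1// (lt_le_trans ltr01).
by have := aL u 0; rewrite atan0 !subr0 mul1r (ger0_norm u0).
Qed.

Lemma sin_lip : lip 1 (@sin R).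
Proof. by apply: (lip_of_derive (fun x => is_derive_sin x)) => x; exact: cos_max. Qed.

Lemma expR_dist1 t : `|expR t - 1| <= `|t| * expR `|t|.
Proof.
have [t0|t0] := leP 0 t.
  rewrite ger0_norm; last by rewrite subr_ge0 (le_trans _ (expR_ge1Dx t))// lerDl.
  have := expR_ge1Dx (- t); rewrite expRN => H.
  rewrite (ger0_norm t0).
  have := ler_wpM2r (expR_ge0 t) H; rewrite mulVf ?gt_eqF ?expR_gt0// mulrDl mul1r; lra.
rewrite ler0_norm; last by rewrite subr_le0 expR_le1 ltW.
have := expR_ge1Dx t; have : 1 <= expR (- t).
  by rewrite (le_trans _ (expR_ge1Dx (- t)))// lerDl oppr_ge0 ltW.
move=> h1 h2; apply: (@le_trans _ _ (- t)); first by lra.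
by rewrite (ltr0_norm t0) ler_peMr// oppr_ge0 ltW.
Qed.

Lemma cauchy_transform_bounded w mu a a0 b0 b delta C : continual_diagram w ->
  transition_measure w mu -> a < a0 -> a0 < b0 -> b0 < b -> 0 < delta ->
  (forall z1 z2, z1 \in `[a, b] -> z2 \in `[a, b] ->
     `|w z1 - w z2| <= (1 - delta) * `|z1 - z2|) ->
  0 <= C ->
  (forall A, measurable A -> A `<=` `[a, b]%classic -> (mu A <= C%:E * leb A)%E) ->
  exists2 C0 : R, 0 < C0 & forall x y : R, a0 <= x <= b0 -> 0 < y ->
    `|Gre mu x y| <= C0 / (1 + y) /\ `|Gim mu x y| <= C0 / (1 + y).
Proof.
move=> dw wmu aa0 ab0 b0b delta0 wab Cge0 muC.
(* The margin: [[x - m, x + m]] lies in [[a, b]] for every [x] in [[a0, b0]], which makes all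
   constants uniform in [x]. *)
pose m : R := Num.min (a0 - a) (b - b0).
have m0 : 0 < m by rewrite lt_min !subr_gt0 aa0 b0b.
have ma : m <= a0 - a by rewrite ge_min lexx.
have mb : m <= b - b0 by rewrite ge_min lexx orbT.
have ab : a < b by lra.
(* From height [y <= 1] the interval [[a, b]] is seen under an angle of at least [2 * atan m]. *)
pose k : R := delta * atan m.
have k0 : 0 < k by rewrite mulr_gt0// -atan0 lt_atan.
have kappa (x y : R) : a0 <= x <= b0 -> 0 < y -> y <= 1 ->
    k <= delta / 2 * (angle x y b - angle x y a).
  move=> /andP[ax xb] y0 y1.
  have h1 : atan m <= angle x y b.
    apply: le_atan; rewrite ler_pdivlMr//; apply: (@le_trans _ _ m); last by lra.
    by rewrite ler_piMr// ltW.
  have h2 : angle x y a <= - atan m.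
    rewrite -atanN; apply: le_atan; rewrite ler_pdivrMr// mulNr.
    have : m * y <= m by rewrite ler_piMr// ltW.
    by lra.
  have h3 : 2 * atan m <= angle x y b - angle x y a by lra.
  have := ler_wpM2l (ltW delta0) h3; rewrite /k; lra.
have beta (x y : R) : a0 <= x <= b0 -> 0 < y -> y <= 1 ->
    `|Lim_ w x y + angle x y 0| <= pi / 2 - k.
  move=> xab y0 y1; have := Lim_angle x dw ab delta0 wab y0.
  by have := kappa x y xab y0 y1; lra.
have k1 : 0 <= pi / 2 - k.
  apply: (le_trans (normr_ge0 _) (beta a0 1 _ ltr01 (lexx _))).
  by rewrite lexx ltW.
(* The least cosine that [beta] allows, so the modulus is at most [- Gim / c]. *)
pose c : R := cos (pi / 2 - k).
have c0 : 0 < c.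
  by apply: cos_gt0_pihalf; apply/andP; split; have := pi_gt0 R; lra.
pose D : R := C * pi + 1 / m ^+ 2.
have D0 : 0 <= D.
  by rewrite /D addr_ge0// ?(mulr_ge0 Cge0 (pi_ge0 R))// divr_ge0// exprn_ge0// ltW.
have small (x y : R) : a0 <= x <= b0 -> 0 < y -> y <= 1 ->
    `|Gre mu x y| <= D / c /\ `|Gim mu x y| <= D / c.
  move=> xab y0 y1; have [-> GE] := cauchy_polar x wmu y0.
  set r := cauchy_modulus w x y in GE *; have r0 : 0 < r by exact: cauchy_modulus_gt0.
  clearbody r.
  have be := beta x y xab y0 y1.
  have cb : c <= cos (Lim_ w x y + angle x y 0).
    rewrite -cos_norm leNgt ltr_cos -?leNgt// in_itv/= ?normr_ge0 ?k1/=.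
      by have := pi_gt0 R; lra.
    by apply: (le_trans be); have := pi_gt0 R; lra.
  have rD : r <= D / c.
    rewrite ler_pdivlMr//.
    have /andP[ax xb] := xab.
    have : - Gim mu x y <= C * pi + y / m ^+ 2.
      by apply: (@Gim_density _ mu x y a b m C) => //; lra.
    rewrite GE opprK => H; apply: (@le_trans _ _ (r * cos (Lim_ w x y + angle x y 0))).
      by rewrite ler_pM2l.
    apply: (le_trans H); by rewrite lerD2l ler_wpM2r// invr_ge0 exprn_ge0 ?(ltW m0).
  rewrite GE !normrN !normrM (gtr0_norm r0); split; apply: le_trans rD;
    rewrite ler_piMr ?(ltW r0)//; [exact: sin_max|exact: cos_max].
have Dc : 0 <= D / c by rewrite divr_ge0// ltW.
(* For [y <= 1] the bound [D / c] loses a factor [1 + y <= 2]; for [y > 1] the trivial bound [1 / y]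
   is at most [2 / (1 + y)]. *)
exists (2 * (D / c) + 2); first by lra.
move=> x y xab y0.
have y10 : 0 < 1 + y by lra.
suff H M : (y <= 1 -> M <= D / c) -> M <= y^-1 -> M <= (2 * (D / c) + 2) / (1 + y).
  have [|] := leP y 1.
    by move=> y1; have [h1 h2] := small x y xab y0 y1; split; apply: H => //;
      [exact: Gre_bound|exact: Gim_bound].
  move=> y1; split; apply: H; try by rewrite leNgt y1.
    exact: Gre_bound.
  exact: Gim_bound.
have [y1 /(_ isT) MD _|y1 _ My] := leP y 1; rewrite ler_pdivlMr//.
  apply: (@le_trans _ _ (D / c * (1 + y))); first by rewrite ler_wpM2r// ltW.
  have := ler_wpM2l Dc y1; lra.
apply: (@le_trans _ _ (y^-1 * (1 + y))); first by rewrite ler_wpM2r// ltW.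
rewrite mulrDr mulr1 mulVf ?lt0r_neq0//.
have : y^-1 <= 1 by rewrite invf_le1// ltW.
by lra.
Qed.

(** The two moduli have ratio [expR (l1 - l2)], and [sin] is 1-Lipschitz in the argument. The cap
    [eta <= 2] bounds the exponential by [expR 2]. *)
Lemma polar_dist (g1 h1 g2 h2 q l1 l2 b1 b2 eta B : R) : 0 < q ->
  g1 = - (expR (- l1) * q * sin b1) -> h1 = - (expR (- l1) * q * cos b1) ->
  g2 = - (expR (- l2) * q * sin b2) -> h2 = - (expR (- l2) * q * cos b2) ->
  `|l1 - l2| <= eta -> `|b1 - b2| <= eta -> eta <= 2 ->
  `|g1| <= B -> `|h1| <= B ->
  `|g1 - g2| <= 2 * B * (expR 2 + 1) * eta /\ `|h2| <= 2 * B * expR 2.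
Proof.
move=> q0 Er1 Ei1 Er2 Ei2 l12 b12 eta2 B1 B2.
pose r1 : R := expR (- l1) * q.
have r10 : 0 < r1 by rewrite mulr_gt0 ?expR_gt0.
pose D : R := l1 - l2.
have rE : expR (- l2) * q = r1 * expR D.
  rewrite /r1 (_ : - l2 = - l1 + D); last by rewrite /D; ring.
  by rewrite expRD; ring.
rewrite rE in Er2 Ei2; rewrite -/r1 in Er1 Ei1.
clearbody r1.
(* The sum of [|sin b1|] and [|cos b1|] is at least 1, so the modulus is at most [|g1| + |h1|]. *)
have rB : r1 <= 2 * B.
  have : r1 <= r1 * (`|sin b1| + `|cos b1|).
    rewrite ler_peMr ?(ltW r10)//.
    have := cos2Dsin2 b1; have := cos_max b1; have := sin_max b1.
    rewrite -(real_normK (num_real (cos b1))) -(real_normK (num_real (sin b1))).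
    move: (normr_ge0 (cos b1)) (normr_ge0 (sin b1)).
    move: `|cos b1| `|sin b1| => k s k0 s0 s1 k1 sk.
    have := ler_wpM2l s0 s1; have := ler_wpM2l k0 k1; rewrite -!expr2 !mulr1; lra.
  move: B1 B2; rewrite Er1 Ei1 !normrN !normrM (gtr0_norm r10); lra.
have D1 : `|D| <= eta by [].
have ED : expR `|D| <= expR 2 by rewrite ler_expR; apply: le_trans eta2.
have ED' : expR D <= expR 2 by apply: le_trans ED; rewrite ler_expR ler_norm.
split.
  rewrite Er1 Er2.
  have -> : - (r1 * sin b1) - - (r1 * expR D * sin b2) =
    r1 * ((expR D - 1) * sin b2 + (sin b2 - sin b1)) by ring.
  rewrite normrM (gtr0_norm r10).
  have h1' : `|(expR D - 1) * sin b2| <= eta * expR 2.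
    rewrite normrM; apply: (@le_trans _ _ (`|expR D - 1| * 1)).
      by rewrite ler_wpM2l// sin_max.
    rewrite mulr1; apply: (le_trans (expR_dist1 D)); apply: ler_pM => //; exact: expR_ge0.
  have h2' : `|sin b2 - sin b1| <= eta.
    by have := sin_lip b2 b1; rewrite mul1r (distrC b2 b1) => /le_trans; apply.
  apply: (@le_trans _ _ (2 * B * (eta * expR 2 + eta))).
    apply: ler_pM => //; first exact: ltW.
    by apply: (le_trans (ler_normD _ _)); exact: lerD.
  by rewrite le_eqVlt; apply/orP; left; apply/eqP; ring.
rewrite Ei2 normrN !normrM (gtr0_norm r10) (gtr0_norm (expR_gt0 D)).
apply: (@le_trans _ _ (r1 * expR D * 1)).
  by rewrite ler_wpM2l ?cos_max// mulr_ge0 ?expR_ge0// ltW.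
by rewrite mulr1; apply: ler_pM => //; rewrite ?expR_ge0 ?(ltW r10).
Qed.

(* Both transforms have the polar form of [cauchy_polar], so they are compared
   through their moduli and arguments. *)
Lemma cauchy_transform_dist w1 w2 mu1 mu2 x y e B : continual_diagram w1 ->
  continual_diagram w2 -> transition_measure w1 mu1 -> transition_measure w2 mu2 ->
  (forall v, `|w1 v - w2 v| <= e) -> 0 < y -> e <= y ->
  `|Gre mu1 x y| <= B -> `|Gim mu1 x y| <= B ->
  `|Gre mu1 x y - Gre mu2 x y| <= 2 * B * (expR 2 + 1) * (2 * (e / y)) /\
  `|Gim mu2 x y| <= 2 * B * expR 2.
Proof.
move=> d1 d2 t1 t2 w12 y0 ey B1 B2.
have e0 : 0 <= e by apply: le_trans (w12 0).
have c0 : 0 < cos (angle x y 0).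
  by apply: cos_gt0_pihalf; rewrite atan_gtNpi2 atan_ltpi2.
have [Er1 Ei1] := cauchy_polar x t1 y0; have [Er2 Ei2] := cauchy_polar x t2 y0.
have D1 := Lre_dist x d1 d2 w12 y0.
have b12 := Lim_dist x d1 d2 w12 y0.
have pE : e * pi / (2 * y) = pi / 2 * (e / y) by field; exact: lt0r_neq0.
have ey0 : 0 <= e / y by rewrite divr_ge0 ?(ltW y0).
have pe : e * pi / (2 * y) <= 2 * (e / y).
  by rewrite pE ler_wpM2r// ltW// pihalf_lt2.
have pe2 : e * pi / (2 * y) <= 2.
  have ey1 : e / y <= 1 by rewrite ler_pdivrMr// mul1r.
  rewrite pE; apply: (@le_trans _ _ (pi / 2)); last by rewrite ltW// pihalf_lt2.
  by rewrite ler_piMr// divr_ge0// pi_ge0.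
have bE : `|(Lim_ w1 x y + angle x y 0) - (Lim_ w2 x y + angle x y 0)| <= e * pi / (2 * y).
  have sub_same (p q s : R) : (p + s) - (q + s) = p - q by ring.
  rewrite sub_same; exact: b12.
have Bge0 : 0 <= B by apply: le_trans B1.
have [H1 H2] := polar_dist (divr_gt0 c0 y0) Er1 Ei1 Er2 Ei2 D1 bE pe2 B1 B2.
split=> //; apply: (le_trans H1); rewrite ler_wpM2l//.
by rewrite !mulr_ge0// addr_ge0 ?expR_ge0.
Qed.

End cauchy_transform_estimates.

(** * Recovering the cumulative function *)

Section calculus.
Context {R : realType}.
Implicit Types (f g : R -> R) (x y u C M e eta : R).

(** The function [2 / (1 + v) + atan v] is nonincreasing, because [(1 + v) ^ 2 <= 2 (1 + v ^ 2)],
    and it stays above [atan v], which tends to [pi / 2]. *)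
Lemma pi_half_sub_atan_le u : 0 <= u -> pi / 2 - atan u <= 2 / (1 + u).
Proof.
move=> u0; pose f (v : R) : R := 2 / (1 + v) + atan v.
have df (v : R) : 0 <= v -> is_derive v 1 f (- 2 / (1 + v) ^+ 2 + (1 + v ^+ 2)^-1).
  move=> v0; have n0 : 1 + v != 0 by apply: lt0r_neq0; lra.
  rewrite /f; apply: is_derive_eq; rewrite /GRing.scale/=; field.
  by rewrite n0 andbT; apply: lt0r_neq0; rewrite ltr_pwDl// sqr_ge0.
suff H : pi / 2 <= f u by move: H; rewrite /f; lra.
apply: (cvgr_to_le (@cvgy_atan R)).
near=> Y.
have uY : u <= Y by near: Y; apply: nbhs_pinfty_ge; exact: num_real.
have Y0 : 0 <= Y by exact: le_trans uY.
have fY : atan Y <= f Y by rewrite /f lerDr divr_ge0// addr_ge0.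
apply: (le_trans fY).
apply: (@ler0_derive1_nincry _ f 0) => //.
- move=> v; rewrite in_itv/= andbT => v0; have := df v (ltW v0) => H; exact: ex_derive.
- move=> v; rewrite in_itv/= andbT => v0.
  rewrite (iffLR (is_derive1P _ _ _) (df v (ltW v0))).2.
  have a0 : 0 < 1 + v ^+ 2 by rewrite ltr_pwDl// sqr_ge0.
  have b0 : 0 < (1 + v) ^+ 2 by rewrite exprn_gt0// addr_gt0.
  rewrite mulNr addrC subr_le0 ler_pdivlMr// mulrC ler_pdivrMr//.
  by have := sqr_ge0 (1 - v); rewrite sqrrB sqrrD; lra.
- apply: derivable_within_continuous => v; rewrite in_itv/= andbT => v0.
  by have := df v v0 => H; exact: ex_derive.
Unshelve. all: by end_near. Qed.

(* The primitive of [1 / (y (1 + y))] vanishing at infinity is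
   [- ln (1 + 1 / y)]; the bound is integrated from [eta] to infinity. *)
Lemma decay_bound_le f (f' : R -> R) C M eta : 0 < eta -> 0 <= C ->
  (forall y : R, eta <= y -> is_derive y 1 f (f' y)) ->
  (forall y, eta <= y -> f' y <= C / (y * (1 + y))) ->
  (forall y, eta <= y -> - f y <= M / y) ->
  - f eta <= C * ln (1 + eta^-1).
Proof.
move=> eta0 C0 df f'C fM.
pose g (y : R) : R := f y + C * (ln (1 + y) - ln y).
have dg (y : R) : eta <= y -> is_derive y 1 g (f' y - C / (y * (1 + y))).
  move=> ey; have dfy := df y ey.
  have y0 : 0 < y by exact: lt_le_trans ey.
  have y10 : 0 < 1 + y by rewrite addr_gt0.
  have d1 : is_derive y 1 (@ln R) y^-1 by exact: is_derive1_ln.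
  have d2 : is_derive (1 + y) 1 (@ln R) (1 + y)^-1 by exact: is_derive1_ln.
  have d3 : is_derive y 1 (fun z : R => ln (1 + z)) (1 + y)^-1.
    have d4 : is_derive y 1 (fun z : R => 1 + z) 1.
      by have := is_deriveD (is_derive_cst (1 : R) y 1) (is_derive_id y 1); rewrite add0r.
    have := @is_derive1_comp _ (@ln R) _ y _ _ d2 d4.
    by rewrite mulr1.
  rewrite /g; apply: is_derive_eq; rewrite /GRing.scale/=; congr (_ + _).
  by field; rewrite !lt0r_neq0.
have gE : g eta = f eta + C * ln (1 + eta^-1).
  rewrite /g -ln_div ?posrE ?addr_gt0//; congr (_ + _ * ln _).
  by field; exact: lt0r_neq0.
suff : 0 <= g eta by rewrite gE; lra.
have gY Y : eta <= Y -> - (M / Y) <= g eta.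
  move=> eY; have Y0 : 0 < Y by exact: lt_le_trans eY.
  apply: (@le_trans _ _ (g Y)).
    have l0 : ln Y <= ln (1 + Y) by rewrite ler_ln ?posrE ?addr_gt0// lerDr.
    have := mulr_ge0 C0 (_ : 0 <= ln (1 + Y) - ln Y); rewrite subr_ge0 => /(_ l0).
    by have := fM Y eY; rewrite /g; lra.
  apply: (@ler0_derive1_nincry _ g eta) => //.
  - move=> v; rewrite in_itv/= andbT => v0; have := dg v (ltW v0) => H; exact: ex_derive.
  - move=> v; rewrite in_itv/= andbT => v0.
    rewrite (iffLR (is_derive1P _ _ _) (dg v (ltW v0))).2.
    by rewrite subr_le0 f'C// ltW.
  - apply: derivable_within_continuous => v; rewrite in_itv/= andbT => v0.
    by have := dg v v0 => H; exact: ex_derive.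
rewrite leNgt; apply/negP => g0.
(* Far enough that [|M| / Y] drops below [- g eta]. *)
pose Y : R := eta + `|M| / (- g eta) + 1.
have ng : 0 < - g eta by rewrite oppr_gt0.
have Mg : 0 <= `|M| / (- g eta) by rewrite divr_ge0// ltW.
have eY : eta <= Y by rewrite /Y; lra.
have Y0 : 0 < Y by exact: lt_le_trans eY.
have : - g eta <= `|M| / Y.
  apply: (@le_trans _ _ (M / Y)); first by have := gY Y eY; lra.
  by rewrite ler_wpM2r ?ler_norm// invr_ge0 ltW.
rewrite ler_pdivlMr// leNgt => /negP; apply.
by rewrite mulrC -ltr_pdivrMr// /Y; lra.
Qed.

Lemma decay_bound f (f' : R -> R) C M eta : 0 < eta -> 0 <= C ->
  (forall y : R, eta <= y -> is_derive y 1 f (f' y)) ->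
  (forall y, eta <= y -> `|f' y| <= C / (y * (1 + y))) ->
  (forall y, eta <= y -> `|f y| <= M / y) ->
  `|f eta| <= C * ln (1 + eta^-1).
Proof.
move=> eta0 C0 df f'C fM; rewrite ler_norml; apply/andP; split.
  rewrite lerNl; apply: (decay_bound_le eta0 C0 df) => y ey.
    by apply: (le_trans (ler_norm _)); exact: f'C.
  by apply: le_trans (fM y ey); rewrite -normrN ler_norm.
rewrite -[leLHS]opprK; apply: (@decay_bound_le (fun y => - f y) (fun y => - f' y) C M) => //.
- by move=> y ey; have dfy := df y ey; apply: is_deriveN.
- by move=> y ey; apply: le_trans (f'C y ey); rewrite -normrN ler_norm.
- by move=> y ey; rewrite opprK; apply: le_trans (fM y ey); exact: ler_norm.
Qed.

End calculus.

Section derive_under_probability.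
Context d (T : measurableType d) (R : realType) (P : probability T R).

(** Domination on []y / 2, 2 y[]. The bounds are sums so as to cover both integrands of interest:
    [atan ((z - t) / y)], bounded by [pi], and the one of [smooth_error]. *)
Lemma is_derive_Rintegral_prob (f f' : R -> T -> R) (y : R) : 0 < y ->
  (forall z, 0 < z -> measurable_fun setT (f z)) ->
  (forall z t, 0 < z -> `|f z t| <= pi + z^-1) ->
  (forall (z : R) t, 0 < z -> is_derive z 1 (fun z => f z t) (f' z t)) ->
  (forall z t, 0 < z -> `|f' z t| <= (z ^+ 2)^-1 + z^-1) ->
  is_derive y 1 (fun z => Rintegral P setT (f z)) (Rintegral P setT (f' y)).
Proof.
move=> y0 mf fB df f'B.
pose I : set R := `](y / 2), (2 * y)[%classic.
have I0 z : I z -> 0 < z.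
  rewrite /I/= in_itv/= => /andP[+ _]; apply: lt_trans; exact: divr_gt0.
have Iy : I y by rewrite /I/= in_itv/=; apply/andP; split; lra.
have h1 z : I z -> P.-integrable setT (EFin \o f z).
  move=> /I0 z0; apply: (@bounded_integrable_prob _ _ _ P _ (pi + z^-1)); first exact: mf.
  by move=> t; exact: fB.
have h2 z t : I z -> setT t -> derivable (fun z => f z t) z 1.
  by move=> /I0 z0 _; have := df z t z0 => H; exact: ex_derive.
pose G (t : T) : R := ((y / 2) ^+ 2)^-1 + (y / 2)^-1.
have y20 : 0 < y / 2 by rewrite divr_gt0.
have G0 t : 0 <= G t by rewrite addr_ge0// invr_ge0 ?exprn_ge0// ltW.
have Gi : P.-integrable setT (EFin \o G).
  apply: (@bounded_integrable_prob _ _ _ P _ `|((y / 2) ^+ 2)^-1 + (y / 2)^-1|) => //.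
  exact: measurable_cst.
have dE z t : 0 < z -> partial1of2 f z t = f' z t.
  by move=> z0; rewrite /partial1of2 (iffLR (is_derive1P _ _ _) (df z t z0)).2.
have h3 z t : I z -> setT t -> `|partial1of2 f z t| <= G t.
  move=> Iz _; have z0 := I0 _ Iz; rewrite dE//; apply: (le_trans (f'B z t z0)).
  have zy : y / 2 <= z by move: Iz; rewrite /I/= in_itv/= => /andP[/ltW].
  rewrite /G lerD// lef_pV2 ?posrE ?exprn_gt0//.
  by rewrite lerXn2r// nnegrE ltW.
apply/is_derive1P; split.
  exact: (@derivable_under_integral _ _ _ P f setT measurableT y (y / 2) (2 * y) Iy h1 h2 G G0 Gi h3).
rewrite (@differentiation_under_integral _ _ _ P f setT measurableT y (y / 2) (2 * y) Iy h1 h2 G G0 Gi h3).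
by apply: eq_Rintegral => t _; exact: dE.
Qed.

End derive_under_probability.

(** * Smoothing at scale [y] and its cost *)

Section smoothed_cumulative_function.
Context {R : realType}.
Implicit Types (mu : probability R R) (w : R -> R) (x y z s t e : R).

(* [1 / 2 + smooth_cumul mu z y / pi] is the convolution of the cumulative
   function of [mu] with a Cauchy law of scale [y]. *)
Definition smooth_cumul mu z y := Rintegral mu setT (fun t => atan ((z - t) / y)).

Lemma GimE mu z y : Gim mu z y = Rintegral mu setT (cauchy_im z y).
Proof. by []. Qed.

Lemma Gim_le0 mu z y : 0 < y -> Gim mu z y <= 0.
Proof.
move=> y0; rewrite -oppr_ge0 GimE -[leRHS]mulN1r -RintegralZl//; last first.
  apply: (bounded_integrable_prob mu _ (fun v => cauchy_im_bound z v y0)).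
  exact: measurable_cauchy_im.
apply: Rintegral_ge0 => t _.
by rewrite mulN1r /cauchy_im mulNr opprK divr_ge0 ?ltW// cauchy_den_gt0.
Qed.

(** The smoothing cost is [y] times this; without that factor the derivative in [y] compares
    directly with [Gim]. *)
Definition smooth_error mu z y := Rintegral mu setT (fun t => (`|z - t| + y)^-1).

Lemma atan_angle z y t : atan ((z - t) / y) = - angle z y t.
Proof. by rewrite /angle -atanN -mulNr opprB. Qed.

Lemma atan_quot_lip z y : 0 < y -> lip y^-1 (fun t => atan ((z - t) / y)).
Proof.
move=> y0 s t; rewrite !atan_angle -opprD normrN.
exact: angle_lip.
Qed.

Lemma pi_norm_atan (u : R) : `|atan u| <= pi.
Proof.
have := atan_gtNpi2 u; have := atan_ltpi2 u; rewrite ler_norml; have := pi_gt0 R => *.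
by apply/andP; split; lra.
Qed.

Lemma is_derive_smooth_cumul mu z y : 0 < y ->
  is_derive y 1 (smooth_cumul mu z) (- Gre mu z y).
Proof.
move=> y0.
have -> : - Gre mu z y = Rintegral mu setT (fun t => - 1 * cauchy_re z y t).
  rewrite RintegralZl// ?mulN1r//.
  apply: (bounded_integrable_prob mu _ (fun v => cauchy_re_bound z v y0)).
  exact: measurable_cauchy_re.
apply: (@is_derive_Rintegral_prob _ _ _ mu (fun y t => atan ((z - t) / y))
  (fun y t => - 1 * cauchy_re z y t)) => //.
- by move=> v v0; exact: lip_measurable (atan_quot_lip z v0).
- move=> v t v0; apply: (le_trans (pi_norm_atan _)).
  by rewrite lerDl invr_ge0 ltW.
- move=> v t v0; have vn := lt0r_neq0 v0.
  have N0 := lt0r_neq0 (cauchy_den_gt0 z t v0).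
  have M0 : 1 + ((z - t) / v) ^+ 2 != 0.
    by apply: lt0r_neq0; rewrite ltr_pwDl// sqr_ge0.
  have dV : is_derive v 1 (fun y : R => y^-1) (- v ^- 2 *: 1).
    exact: (@is_deriveV _ id v 1 1 vn).
  have d1 : is_derive v 1 (fun y : R => (z - t) / y) (- (z - t) / v ^+ 2).
    by apply: is_derive_eq; rewrite /GRing.scale/=; field; exact: vn.
  have := @is_derive1_comp _ (@atan R) _ v _ _ (is_derive1_atan ((z - t) / v)) d1.
  have -> : (1 + ((z - t) / v) ^+ 2)^-1 * (- (z - t) / v ^+ 2) = - 1 * cauchy_re z v t.
    rewrite /cauchy_re; field; rewrite vn N0 /=.
    by move: N0; rewrite addrC.
  by [].
- move=> v t v0; rewrite mulN1r normrN; apply: (le_trans (cauchy_re_bound z t v0)).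
  by rewrite lerDr invr_ge0 exprn_ge0// ltW.
Qed.

(** Compactness of the support enters here: [|atan u| <= |u|] and [|z - t|] is almost surely
    bounded. *)
Lemma smooth_cumul_decay w mu z : transition_measure w mu ->
  exists M, forall y, 0 < y -> `|smooth_cumul mu z y| <= M / y.
Proof.
move=> [[M muM] _]; exists (`|z| + `|M|) => y y0.
apply: (@ae_Rintegral_prob_bound _ _ _ mu _ _ pi).
- exact: lip_measurable (atan_quot_lip z y0).
- by move=> t; exact: pi_norm_atan.
- exists [set t | M < `|t|]; split => //.
    rewrite (_ : [set t | _] = (fun t : R => `|t|) @^-1` `]M, +oo[%classic); last first.
      by apply/seteqP; split => t /=; rewrite in_itv/= andbT.
    rewrite -[X in measurable X]setTI; exact: normr_measurable.
  move=> t /= H; rewrite ltNge; apply: contra_notN H => tM.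
  have aE : `|atan ((z - t) / y)| = `|atan `|(z - t) / y| |.
    have [h|h] := leP 0 ((z - t) / y); first by rewrite (ger0_norm h).
    by rewrite (ltr0_norm h) atanN normrN.
  rewrite aE; apply: (le_trans (atan_le_id (normr_ge0 _))).
  rewrite normrM normfV (gtr0_norm y0) ler_wpM2r ?invr_ge0 ?(ltW y0)//.
  apply: (le_trans (ler_normB _ _)); rewrite lerD2l (le_trans tM)//.
  exact: ler_norm.
Qed.

Lemma smooth_error_lip z y : 0 < y -> lip (y ^+ 2)^-1 (fun t => (`|z - t| + y)^-1).
Proof.
move=> y0 s t.
have p (r : R) : 0 < `|z - r| + y by rewrite ltr_wpDl.
have pn (r : R) := lt0r_neq0 (p r).
have -> : (`|z - s| + y)^-1 - (`|z - t| + y)^-1 =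
  (`|z - s| + y)^-1 * (`|z - t| + y)^-1 * (`|z - t| - `|z - s|).
  by field; rewrite !pn.
rewrite normrM; apply: ler_pM => //.
  have q (r : R) : (`|z - r| + y)^-1 <= y^-1 by rewrite lef_pV2 ?posrE// lerDr.
  have q0 (r : R) : 0 <= (`|z - r| + y)^-1 by rewrite invr_ge0 ltW.
  rewrite ger0_norm ?mulr_ge0// (_ : (y ^+ 2)^-1 = y^-1 * y^-1); last by rewrite -exprVn.
  by apply: ler_pM.
apply: (le_trans (ler_dist_dist _ _)).
by rewrite (_ : z - t - (z - s) = s - t)//; ring.
Qed.

Lemma smooth_error_term_le z y t : 0 < y -> `|(`|z - t| + y)^-1| <= y^-1.
Proof.
move=> y0; have p : 0 < `|z - t| + y by rewrite ltr_wpDl.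
by rewrite normfV (gtr0_norm p) lef_pV2 ?posrE// lerDr.
Qed.

Lemma smooth_error_bound mu z y : 0 < y -> `|smooth_error mu z y| <= y^-1.
Proof.
move=> y0; apply: Rintegral_prob_bound; first exact: lip_measurable (smooth_error_lip z y0).
by move=> t; exact: smooth_error_term_le.
Qed.

(** Since [(|z - t| + y) ^ 2 >= (z - t) ^ 2 + y ^ 2], the differentiated integrand is at most the
    Poisson kernel divided by [y]. *)
Lemma is_derive_smooth_error mu z y : 0 < y -> exists2 D : R,
  is_derive y 1 (smooth_error mu z) D & `|D| <= `|Gim mu z y| / y.
Proof.
move=> y0; exists (Rintegral mu setT (fun t => - ((`|z - t| + y)^-1 * (`|z - t| + y)^-1))).
  apply: (@is_derive_Rintegral_prob _ _ _ mu (fun y t => (`|z - t| + y)^-1)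
    (fun y t => - ((`|z - t| + y)^-1 * (`|z - t| + y)^-1))) => //.
  - by move=> v v0; exact: lip_measurable (smooth_error_lip z v0).
  - move=> v t v0; apply: (le_trans (smooth_error_term_le z t v0)).
    by rewrite lerDr pi_ge0.
  - move=> v t v0; have p : `|z - t| + v != 0 by rewrite lt0r_neq0// ltr_wpDl.
    apply: is_derive_eq; rewrite /GRing.scale/=; field; exact: p.
  - move=> v t v0; rewrite normrN normrM -exprVn expr2.
    apply: (@le_trans _ _ (v^-1 * v^-1)).
      by apply: ler_pM => //; exact: smooth_error_term_le.
    by rewrite lerDl invr_ge0 ltW.
have mI := measurable_cauchy_im z y0.
have bI v := cauchy_im_bound z v y0.
have gi := bounded_integrable_prob mu mI bI.
have ge : `|Gim mu z y| / y = Rintegral mu setT (fun t => - y^-1 * cauchy_im z y t).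
  rewrite RintegralZl// -GimE (ler0_norm (Gim_le0 mu z y0)).
  by rewrite !mulNr mulrC.
have mq : measurable_fun setT (fun t : R => - ((`|z - t| + y)^-1 * (`|z - t| + y)^-1)).
  have mE := lip_measurable (smooth_error_lip z y0).
  rewrite (_ : (fun _ => _) = (fun t => 0 - (`|z - t| + y)^-1 * (`|z - t| + y)^-1)).
    by apply: measurable_funB => //; exact: measurable_funM.
  by apply/funext => t; rewrite sub0r.
have qi : mu.-integrable setT (EFin \o (fun t : R => - ((`|z - t| + y)^-1 * (`|z - t| + y)^-1))).
  apply: (@bounded_integrable_prob _ _ _ mu _ (y^-1 * y^-1) mq) => t.
  by rewrite normrN normrM; apply: ler_pM => //; exact: smooth_error_term_le.
apply: (le_trans (le_normr_Rintegral measurableT qi)).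
rewrite ge; apply: le_Rintegral => //.
- apply/integrableP; split.
    apply/measurable_EFinP; apply: measurableT_comp => //; exact: normr_measurable.
  under eq_integral do rewrite /= normr_id.
  by case/integrableP : qi.
- exact: integrable_EFinZl.
move=> t _; have p : 0 < `|z - t| + y by rewrite ltr_wpDl.
rewrite normrN normrM normfV (gtr0_norm p) -invfM /cauchy_im.
have -> : - y^-1 * (- y / ((z - t) ^+ 2 + y ^+ 2)) = ((z - t) ^+ 2 + y ^+ 2)^-1.
  have yn := lt0r_neq0 y0; have N0 := lt0r_neq0 (cauchy_den_gt0 z t y0).
  by field; rewrite yn N0.
rewrite lef_pV2 ?posrE ?cauchy_den_gt0 ?mulr_gt0//.
rewrite -(real_normK (num_real (z - t))).
have := mulr_ge0 (normr_ge0 (z - t)) (ltW y0); rewrite !expr2 mulrDl !mulrDr; lra.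
Qed.

(** Oddness of [atan] reduces both signs to [pi_half_sub_atan_le] at [|s| / e]; its factor 2 is
    absorbed by [pi >= 2]. *)
Lemma heaviside_sub_atan s e : 0 < e ->
  `|(if 0 <= s then 1 else 0) - 2^-1 - atan (s / e) / pi| <= e * (`|s| + e)^-1.
Proof.
move=> e0; have pi0 := pi_gt0 R; have en := lt0r_neq0 e0.
have key (u : R) : 0 <= u -> 0 <= 2^-1 - atan u / pi <= (1 + u)^-1.
  move=> u0; have := pi_half_sub_atan_le u0; have := atan_ltpi2 u.
  have -> : 2^-1 - atan u / pi = (pi / 2 - atan u) / pi.
    by rewrite mulrBl mulrAC divff ?mul1r// lt0r_neq0.
  move=> h1 h2; apply/andP; split; first by apply: divr_ge0; [rewrite subr_ge0 ltW|exact: ltW].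
  rewrite ler_pdivrMr//; apply: (le_trans h2); rewrite mulrC ler_wpM2l ?pi_ge2//.
  by rewrite invr_ge0 addr_ge0.
have eE (u : R) : 0 <= u -> e * (u * e + e)^-1 = (1 + u)^-1.
  move=> u0; have n0 : 1 + u != 0 by rewrite lt0r_neq0// ltr_pwDl.
  have -> : u * e + e = (1 + u) * e by ring.
  by rewrite invfM mulrCA divff// mulr1.
have [s0|s0] := leP 0 s.
  have u0 : 0 <= s / e by rewrite divr_ge0// ltW.
  have /andP[h1 h2] := key _ u0.
  rewrite (ger0_norm s0) -{2}(divfK en s) eE//.
  rewrite (_ : 1 - 2^-1 - atan (s / e) / pi = 2^-1 - atan (s / e) / pi); last first.
    by congr (_ - _); rewrite {1}(splitr 1) mul1r addrK.
  by rewrite ger0_norm.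
have u0 : 0 <= - s / e by apply: divr_ge0; [rewrite oppr_ge0 ltW|exact: ltW].
have /andP[h1 h2] := key _ u0.
rewrite (ltr0_norm s0) -{1}(divfK en (- s)) eE//.
rewrite (_ : s / e = - (- s / e)); last by rewrite mulNr opprK.
rewrite atanN (_ : 0 - 2^-1 - - atan (- s / e) / pi = - (2^-1 - atan (- s / e) / pi)).
  by rewrite normrN ger0_norm.
by ring.
Qed.

Lemma cumul_smooth mu z e : 0 < e ->
  `|fine (cumul mu z) - 2^-1 - smooth_cumul mu z e / pi| <= e * smooth_error mu z e.
Proof.
move=> e0.
pose h (t : R) : R := \1_(`]-oo, z]%classic) t.
have mh : measurable_fun setT h by exact: measurable_indic.
have hB t : `|h t| <= 1 by rewrite /h indicE; case: (_ \in _); rewrite ?normr1 ?normr0.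
have hi := bounded_integrable_prob mu mh hB.
have ma := lip_measurable (atan_quot_lip z e0).
have aB t : `|atan ((z - t) / e)| <= pi by exact: pi_norm_atan.
have ai := bounded_integrable_prob mu ma aB.
have ei := bounded_integrable_prob mu (lip_measurable (smooth_error_lip z e0))
  (fun t => smooth_error_term_le z t e0).
have ci : mu.-integrable setT (EFin \o fun=> (2^-1 : R)).
  by apply: (@bounded_integrable_prob _ _ _ mu _ `|2^-1 : R|).
have -> : fine (cumul mu z) = Rintegral mu setT h.
  by rewrite /Rintegral integral_indic// setIT.
have -> : 2^-1 = Rintegral mu setT (fun=> 2^-1 : R) by rewrite Rintegral_prob_cst.
rewrite /smooth_cumul [_ / pi]mulrC -RintegralZl//.
have pai : mu.-integrable setT (EFin \o (fun t => pi^-1 * atan ((z - t) / e))).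
  exact: integrable_EFinZl.
have hci := integrable_EFinB measurableT hi ci.
have alli := integrable_EFinB measurableT hci pai.
rewrite -RintegralB// -RintegralB//.
apply: (le_trans (le_normr_Rintegral measurableT alli)).
rewrite /smooth_error -RintegralZl//; apply: le_Rintegral => //.
- apply/integrableP; split.
    apply/measurable_EFinP; apply: measurableT_comp; first exact: normr_measurable.
    by apply/measurable_EFinP; exact: measurable_int alli.
  under eq_integral do rewrite /= normr_id.
  by case/integrableP : alli.
- exact: integrable_EFinZl.
move=> t _; have := heaviside_sub_atan (z - t) e0.
rewrite /h indicE (mulrC _ pi^-1).
have -> : (t \in `]-oo, z]%classic) = (0 <= z - t).
  by rewrite subr_ge0; apply/idP/idP; rewrite inE/= in_itv.
by case: ifP.
Qed.

End smoothed_cumulative_function.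

(** * Stability of the cumulative function *)

Section stability.
Context {R : realType}.
Implicit Types (mu : probability R R) (w : R -> R) (x y z e C : R).

Lemma smooth_error_le mu z C e : 0 < e -> 0 <= C ->
  (forall y, e <= y -> `|Gim mu z y| <= C / (1 + y)) ->
  `|smooth_error mu z e| <= C * ln (1 + e^-1).
Proof.
move=> e0 C0 GC.
have gt0 (y : R) : e <= y -> 0 < y by exact: lt_le_trans.
have D (y : R) : exists D : R, e <= y ->
    is_derive y 1 (smooth_error mu z) D /\ `|D| <= `|Gim mu z y| / y.
  have [ey|ey] := leP e y; last by exists 0.
  by have [D D1 D2] := is_derive_smooth_error mu z (gt0 y ey); exists D.
(* Derivatives known to exist pointwise become a function; its values below [e] are arbitrary. *)
have [f' f'P] := choice D.
apply: (@decay_bound _ (smooth_error mu z) f' C 1 e e0 C0) => y ey.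
- by have [] := f'P y ey.
- have [_ /le_trans] := f'P y ey; apply.
  rewrite invfM [y^-1 * _]mulrC mulrA ler_wpM2r ?invr_ge0 ?(ltW (gt0 _ ey))//; exact: GC.
- by rewrite mul1r; apply: smooth_error_bound; exact: gt0.
Qed.

(** Two smoothing costs and one difference of smoothed functions, with constants [1], [2 * expR 2]
    and [4 * (expR 2 + 1)], sum to [6 * expR 2 + 5]. The second cost needs [Gim mu2] only for
    [y >= e], where [cauchy_transform_dist] bounds it. *)
Lemma cumul_stability w1 mu1 x C : continual_diagram w1 ->
  transition_measure w1 mu1 -> 0 < C ->
  (forall y, 0 < y -> `|Gre mu1 x y| <= C / (1 + y) /\ `|Gim mu1 x y| <= C / (1 + y)) ->
  forall w2 mu2 e, continual_diagram w2 -> transition_measure w2 mu2 -> 0 < e ->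
  (forall v, `|w1 v - w2 v| <= e) ->
  `|fine (cumul mu1 x) - fine (cumul mu2 x)| <=
    C * (6 * expR 2 + 5) * (e * ln (1 + e^-1)).
Proof.
move=> d1 t1 C0 GC w2 mu2 e d2 t2 e0 w12.
have gt0 (y : R) : e <= y -> 0 < y by exact: lt_le_trans.
have E0 : 0 <= expR 2 :> R by exact: expR_ge0.
have cmp (y : R) (ey : e <= y) := cauchy_transform_dist d1 d2 t1 t2 w12 (gt0 y ey) ey
  (GC y (gt0 y ey)).1 (GC y (gt0 y ey)).2.
have B1 : `|smooth_error mu1 x e| <= C * ln (1 + e^-1).
  by apply: smooth_error_le => //; [exact: ltW|move=> y ey; exact: (GC y (gt0 y ey)).2].
have B2 : `|smooth_error mu2 x e| <= (2 * C * expR 2) * ln (1 + e^-1).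
  apply: smooth_error_le => //; first by rewrite !mulr_ge0// ltW.
  move=> y ey; apply: (le_trans (cmp y ey).2).
  by rewrite le_eqVlt; apply/orP; left; apply/eqP; ring.
have [M1 A1] := smooth_cumul_decay x t1; have [M2 A2] := smooth_cumul_decay x t2.
pose f (y : R) : R := smooth_cumul mu1 x y - smooth_cumul mu2 x y.
have Af : `|f e| <= (4 * C * (expR 2 + 1) * e) * ln (1 + e^-1).
  apply: (@decay_bound _ f (fun y => - Gre mu1 x y - - Gre mu2 x y) _ (M1 + M2) e e0).
  - by rewrite !mulr_ge0// ?addr_ge0// ltW.
  - move=> y ey; apply: is_deriveB; exact: is_derive_smooth_cumul (gt0 y ey).
  - move=> y ey; rewrite -opprD normrN; apply: (le_trans (cmp y ey).1).
    have yn := lt0r_neq0 (gt0 y ey).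
    have y1 : 1 + y != 0 by rewrite lt0r_neq0// addr_gt0// (gt0 y ey).
    by rewrite le_eqVlt; apply/orP; left; apply/eqP; field; rewrite yn y1.
  - move=> y ey; apply: (le_trans (ler_normB _ _)); rewrite mulrDl; apply: lerD.
      exact: A1 (gt0 y ey).
    exact: A2 (gt0 y ey).
have c1 := cumul_smooth mu1 x e0; have c2 := cumul_smooth mu2 x e0.
move: B1 B2 Af c1 c2; rewrite /f.
move: (fine (cumul mu1 x)) (fine (cumul mu2 x)) => k1 k2.
move: (smooth_cumul mu1 x e) (smooth_cumul mu2 x e) => a1 a2.
move: (smooth_error mu1 x e) (smooth_error mu2 x e) => b1 b2.
have l0 : 0 <= ln (1 + e^-1) by rewrite ln_ge0// lerDl invr_ge0 ltW.
move: (ln _) l0 => l l0 B1 B2 Af c1 c2.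
have -> : k1 - k2 = (k1 - 2^-1 - a1 / pi) - (k2 - 2^-1 - a2 / pi) + (a1 - a2) / pi by rewrite mulrBl; ring.
have h1 : `|(a1 - a2) / pi| <= (4 * C * (expR 2 + 1) * e) * l.
  rewrite normrM normfV (gtr0_norm (pi_gt0 R)) ler_pdivrMr ?pi_gt0//.
  apply: (le_trans Af); rewrite ler_peMr//.
    by rewrite !mulr_ge0// ?addr_ge0// ltW.
  by apply: le_trans (pi_ge2 R); lra.
have h2 : e * b1 <= e * (C * l).
  by rewrite ler_wpM2l ?(ltW e0)//; apply: le_trans B1; exact: ler_norm.
have h3 : e * b2 <= e * (2 * C * expR 2 * l).
  by rewrite ler_wpM2l ?(ltW e0)//; apply: le_trans B2; exact: ler_norm.
apply: (le_trans (ler_normD _ _)).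
apply: (@le_trans _ _ ((e * (C * l) + e * (2 * C * expR 2 * l)) + (4 * C * (expR 2 + 1) * e) * l)).
  rewrite lerD//; apply: (le_trans (ler_normB _ _)); apply: lerD; first exact: le_trans h2.
  exact: le_trans h3.
by rewrite le_eqVlt; apply/orP; left; apply/eqP; ring.
Qed.

End stability.

Section diagram_distance.
Context {R : realType}.
Implicit Types (w : R -> R) (u e : R).
Local Open Scope ereal_scope.

(* Since [w2] is 1-Lipschitz, it is enough that each point of [w1] lies at
   horizontal distance less than [e] from [w2]. *)
Lemma dist_diag_sup w1 w2 e : continual_diagram w1 -> continual_diagram w2 ->
  dist_diag w1 w2 < e%:E -> forall u, (`|w1 u - w2 u| <= 2 * e)%R.
Proof.
move=> d1 d2 dist u; have [w10 _ _] := d1; have [_ w2lip _] := d2.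
have ua := diagram_ge_abs u d1.
(* The point of the graph of [w1] above [u], in the rotated coordinates of the metric. *)
pose x : R := ((w1 u + u) / 2)%R; pose y : R := ((w1 u - u) / 2)%R.
have ule : (- w1 u <= u <= w1 u)%R by rewrite -ler_norml.
have x0 : (0 <= x)%R by rewrite /x; move/andP: ule => [? ?]; lra.
have y0 : (0 <= y)%R by rewrite /y; move/andP: ule => [? ?]; lra.
have xyu : (x - y = u)%R by rewrite /x /y; field.
have xyw : (x + y = w1 u)%R by rewrite /x /y; field.
have xP : PiX w1 y x by rewrite /PiX /= xyu xyw.
have h1 : dX w1 w2 < e%:E by apply: le_lt_trans dist; rewrite /dist_diag le_max lexx.
have h2 : hausdorff (PiX w1 y) (PiX w2 y) < e%:E.
  apply: le_lt_trans h1; rewrite /dX; apply: ereal_sup_ubound; by exists y.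
have h3 : ereal_inf [set (`|x - b|)%:E | b in PiX w2 y] < e%:E.
  apply: le_lt_trans h2; rewrite /hausdorff le_max; apply/orP; left.
  by apply: ereal_sup_ubound; exists x.
have [_ [x' [x'0 x'w] <-]] := ereal_inf_lt h3.
rewrite lte_fin => xx'.
have := w2lip u (x' - y)%R; rewrite x'w -{2}xyu => H.
have E : (w1 u - w2 u = (x - x') - (w2 u - (x' + y)))%R by rewrite -xyw; ring.
have E2 : (x - y - (x' - y) = x - x')%R by ring.
rewrite E2 in H; rewrite E; apply: (le_trans (ler_normB _ _)); lra.
Qed.

End diagram_distance.

(** * Convergence in probability *)

Section rates.
Context {R : realType}.

(* [2 eta / (n ^ alpha ln n)] is the uniform distance between the diagrams; the
   logarithm lost in [cumul_stability] is absorbed by [ln n]. *)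
Lemma rate_bound (alpha eta : R) : 0 < alpha -> 0 < eta ->
  \forall n \near \oo, 0 < n%:R `^ alpha * ln n%:R :> R /\
    n%:R `^ alpha * (2 * eta / (n%:R `^ alpha * ln n%:R) *
      ln (1 + (2 * eta / (n%:R `^ alpha * ln n%:R))^-1)) <= 2 * eta * (alpha + 2).
Proof.
move=> alpha0 eta0.
(* As [ln n <= n], the argument of the logarithm is at most [K n ^ (alpha + 1)], and eventually
   [K <= n]: hence the factor [alpha + 2]. *)
pose K : R := 1 + (2 * eta)^-1.
have K0 : 0 < K by rewrite addr_gt0// invr_gt0 mulr_gt0.
near=> n.
have n2 : (2 <= n)%N by near: n; exists 2%N.
have nK : K <= n%:R by near: n; exact: nbhs_infty_ger.
have n1 : 1 < n%:R :> R by rewrite ltr1n.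
have n0 : 0 < n%:R :> R by exact: lt_trans n1.
have l0 : 0 < ln n%:R :> R by exact: ln_gt0.
have p0 : 0 < n%:R `^ alpha :> R by exact: powR_gt0.
have p1 : 1 <= n%:R `^ alpha :> R.
  by rewrite -[leLHS](powRr0 n%:R) ler_powR// ltW.
split; first exact: mulr_gt0.
set p := n%:R `^ alpha in p0 p1 *; set l := ln n%:R in l0 *.
have ll : l <= n%:R by rewrite ltW// ln_sublinear.
have pn := lt0r_neq0 p0; have ln_n := lt0r_neq0 l0; have en := lt0r_neq0 eta0.
have -> : (2 * eta / (p * l))^-1 = (2 * eta)^-1 * (p * l).
  by rewrite invf_div mulrC.
have h1 : 1 + (2 * eta)^-1 * (p * l) <= K * (p * n%:R).
  have -> : K * (p * n%:R) = p * n%:R + (2 * eta)^-1 * (p * n%:R) by rewrite /K mulrDl mul1r.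
  rewrite lerD//.
    by rewrite -[leLHS]mulr1; apply: ler_pM => //; exact: ltW.
  by rewrite ler_wpM2l ?invr_ge0 ?mulr_ge0 ?(ltW eta0)// ler_wpM2l// ltW.
have a0 : 0 < 1 + (2 * eta)^-1 * (p * l).
  by rewrite addr_gt0// !mulr_gt0// invr_gt0 mulr_gt0.
have pn0 : 0 < p * n%:R by rewrite mulr_gt0.
have h2 : ln (1 + (2 * eta)^-1 * (p * l)) <= (alpha + 2) * l.
  apply: (@le_trans _ _ (ln (K * (p * n%:R)))).
    by rewrite ler_ln ?posrE// mulr_gt0.
  rewrite lnM ?posrE// lnM ?posrE// /p ln_powR -/l.
  have : ln K <= l by rewrite ler_ln ?posrE.
  by lra.
have -> : p * (2 * eta / (p * l) * ln (1 + (2 * eta)^-1 * (p * l))) =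
  2 * eta / l * ln (1 + (2 * eta)^-1 * (p * l)) by field; rewrite pn ln_n.
apply: (@le_trans _ _ (2 * eta / l * ((alpha + 2) * l))).
  by rewrite ler_wpM2l// divr_ge0 ?mulr_ge0 ?(ltW eta0) ?(ltW l0).
by rewrite le_eqVlt; apply/orP; left; apply/eqP; field.
Unshelve. all: by end_near. Qed.

End rates.

Section convergence_in_probability.
Context {R : realType} {d : measure_display} {T : measurableType d}.
Local Open Scope ereal_scope.

Lemma outerP_ge0 (P : probability T R) (A : set T) : 0 <= outerP P A.
Proof. by apply: le_ereal_inf_tmp => _ [B _ <-]. Qed.

Lemma outerP_le (P : probability T R) (A B : set T) : A `<=` B ->
  outerP P A <= outerP P B.
Proof.
move=> AB; apply: ereal_inf_le_tmp => _ [C [mC BC] <-]; exists C => //.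
by split=> //; exact: subset_trans BC.
Qed.

(** The implication is uniform in [t], so it is an inclusion of events, and [outerP] is monotone on
    arbitrary sets. *)
Lemma cvg_prob0_dominated (P : probability T R) (X Y : nat -> T -> \bar R) :
  (forall eps : R, (0 < eps)%R -> exists2 eta : R, (0 < eta)%R &
    \forall n \near \oo, forall t, `|X n t| <= eta%:E -> `|Y n t| <= eps%:E) ->
  cvg_prob0 P X -> cvg_prob0 P Y.
Proof.
move=> XY cX eps eps0; have [eta eta0 H] := XY eps eps0.
apply: (@squeeze_cvge _ _ _ _ (fun=> 0) _ (fun n => outerP P [set t | eta%:E < `|X n t|])).
- near=> n; rewrite outerP_ge0/=; apply: outerP_le => t /=.
  rewrite ltNge => /negP Yt; rewrite ltNge; apply/negP => Xt; apply: Yt.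
  by have Hn := near H n; exact: Hn.
- exact: cvg_cst.
- exact: cX.
Unshelve. all: by end_near. Qed.

End convergence_in_probability.

Section bounded_density.
Context {R : realType}.
Local Notation leb := (@lebesgue_measure R).

Lemma density_measure_le (mu : probability R R) (a b C : R) (rho : R -> R) :
  measurable_fun `[a, b] rho -> (forall x, 0 <= rho x <= C) ->
  (forall A, measurable A -> A `<=` `[a, b]%classic ->
    mu A = (\int[leb]_(x in A) (rho x)%:E)%E) ->
  forall A, measurable A -> A `<=` `[a, b]%classic -> (mu A <= C%:E * leb A)%E.
Proof.
move=> mr rC muE A mA Aab; rewrite (muE A mA Aab) -integral_cst//.
apply: ge0_le_integral => //.
- by move=> x _; rewrite lee_fin; have /andP[] := rC x.
- apply/measurable_EFinP; exact: measurable_funS mr.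
- by move=> x _; rewrite lee_fin; have /andP[] := rC x.
Qed.

End bounded_density.

Theorem mainTheorem2 (R : realType) (alpha : R) (Omega : R -> R)
  (muOmega : probability R R) (a a0 b0 b : R)
  (d : measure_display) (T : measurableType d) (P : probability T R)
  (omega : nat -> T -> R -> R) (mu : nat -> T -> probability R R) :
  0 < alpha ->
  continual_diagram Omega ->
  transition_measure Omega muOmega ->
  a < a0 -> a0 < b0 -> b0 < b ->
  (* (i) Omega is (1-delta)-Lipschitz on [a,b] *)
  (exists delta : R, 0 < delta /\
     forall z1 z2, z1 \in `[a, b] -> z2 \in `[a, b] ->
       `|Omega z1 - Omega z2| <= (1 - delta) * `|z1 - z2|) ->
  (* (ii) mu_Omega restricted to [a,b] has a bounded density *)
  (exists (rho : R -> R) (C : R),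
     measurable_fun `[a, b] rho /\
     (forall x, 0 <= rho x <= C) /\
     forall A, measurable A -> A `<=` `[a, b] ->
       muOmega A = (\int[lebesgue_measure]_(x in A) (rho x)%:E)%E) ->
  (* random continual diagrams and their transition measures *)
  (forall n t, continual_diagram (omega n t)) ->
  (forall n t, transition_measure (omega n t) (mu n t)) ->
  cvg_prob0 P (fun n t =>
     ((n%:R `^ alpha * ln n%:R)%:E * dist_diag Omega (omega n t))%E) ->
  cvg_prob0 P (fun n t =>
     ((n%:R `^ alpha)%:E *
      ereal_sup [set (`|cumul (mu n t) z - cumul muOmega z|)%E | z in `[a0, b0]])%E).
Proof.
move=> alpha0 dO tO aa0 ab0 b0b [delta [delta0 lipO]] [rho [C [mrho [rhoC muE]]]] dw tw.
have C0 : 0 <= C by have /andP[] := rhoC 0; exact: le_trans.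
have [C1 C10 GC] := cauchy_transform_bounded dO tO aa0 ab0 b0b delta0 lipO C0
  (density_measure_le mrho rhoC muE).
pose K : R := C1 * (6 * expR 2 + 5).
have K0 : 0 < K by rewrite mulr_gt0// addr_gt0// mulr_gt0// expR_gt0.
apply: cvg_prob0_dominated => eps eps0.
(* Chosen so that [K] times the bound of [rate_bound] at [2 * eta] equals [eps]. *)
pose eta : R := eps / (2 * (2 * (alpha + 2) * K)).
have eta0 : 0 < eta by rewrite divr_gt0// !mulr_gt0// addr_gt0.
exists eta => //; near=> n => t.
have [pl0 rate] : 0 < n%:R `^ alpha * ln n%:R :> R /\
    n%:R `^ alpha * (2 * (2 * eta) / (n%:R `^ alpha * ln n%:R) *
      ln (1 + (2 * (2 * eta) / (n%:R `^ alpha * ln n%:R))^-1)) <= 2 * (2 * eta) * (alpha + 2).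
  by near: n; apply: rate_bound => //; rewrite mulr_gt0.
set pl := n%:R `^ alpha * ln n%:R in pl0 rate *.
have p0 : 0 <= n%:R `^ alpha :> R by exact: powR_ge0.
move=> distn.
(* Doubling [eta] gives the strict inequality that [dist_diag_sup] asks for, whence [2 * eta] in
   [rate]. *)
have d0 : (dist_diag Omega (omega n t) < (2 * eta / pl)%:E)%E.
  have : (pl%:E * dist_diag Omega (omega n t) <= eta%:E)%E.
    exact: le_trans (lee_abs _) distn.
  rewrite muleC -lee_pdivlMr// => /le_lt_trans; apply.
  rewrite lte_fin ltr_pM2r ?invr_gt0//; lra.
pose e : R := 2 * (2 * eta) / pl.
have eta4 : 0 < 2 * (2 * eta) by rewrite mulr_gt0// mulr_gt0.
have e0 : 0 < e by exact: divr_gt0 eta4 pl0.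
have we v : `|Omega v - omega n t v| <= e.
  by rewrite /e -mulrA; exact: dist_diag_sup dO (dw n t) d0 v.
have bound z : a0 <= z <= b0 ->
    (`|cumul (mu n t) z - cumul muOmega z| <= (K * (e * ln (1 + e^-1)))%:E)%E.
  move=> zab.
  have := @cumul_stability _ Omega muOmega z C1 dO tO C10
    (fun y y0 => GC z y zab y0) (omega n t) (mu n t) e (dw n t) (tw n t) e0 we.
  have f1 : cumul (mu n t) z \is a fin_num by exact: fin_num_measure.
  have f2 : cumul muOmega z \is a fin_num by exact: fin_num_measure.
  by rewrite distrC -(fineK f1) -(fineK f2) -EFinB /= lee_fin.
have supb : (ereal_sup [set (`|cumul (mu n t) z - cumul muOmega z|)%E | z in `[a0, b0]]
    <= (K * (e * ln (1 + e^-1)))%:E)%E.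
  by apply: ge_ereal_sup => _ [z /= zab <-]; apply: bound; move: zab; rewrite in_itv.
have sup0 : (0 <= ereal_sup [set (`|cumul (mu n t) z - cumul muOmega z|)%E | z in `[a0, b0]])%E.
  apply: (@le_trans _ _ (`|cumul (mu n t) a0 - cumul muOmega a0|)%E) => //.
  by apply: ereal_sup_ubound; exists a0 => //=; rewrite in_itv/= lexx ltW.
rewrite gee0_abs; last by rewrite mule_ge0.
apply: (@le_trans _ _ ((n%:R `^ alpha)%:E * (K * (e * ln (1 + e^-1)))%:E)%E).
  by apply: lee_wpmul2l.
rewrite -EFinM lee_fin mulrCA.
apply: (@le_trans _ _ (K * (2 * (2 * eta) * (alpha + 2)))).
  by rewrite ler_wpM2l// ltW.
rewrite /eta le_eqVlt; apply/orP; left; apply/eqP; field.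
by rewrite !lt0r_neq0// addr_gt0.
Unshelve. all: by end_near. Qed.
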